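(* Let $\theta\in[0,2\pi)$, $\hat{\mathbf n}=(\cos\theta,\sin\theta)^T$, $\hat{\mathbf t}=(-\sin\theta,\cos\theta)^T$, let $m:\mathbb R\to\mathbb R$ be a domain wall profile, and let $\chi(u)=Ce^{-\int_0^u m(s)\,ds}$ with $C>0$ the normalization constant. Let $g\in L^2(\mathbb R)$ be a continuous function. If the initial datum of the Dirac equation $$\mathrm i\partial_t\begin{pmatrix}\alpha_1\\ \alpha_2\end{pmatrix}+\begin{pmatrix}\mathrm i\partial_{x_2} & m(\hat{\mathbf n}\cdot\mathbf x)-\partial_{x_1}\\ m(\hat{\mathbf n}\cdot\mathbf x)+\partial_{x_1} & -\mathrm i\partial_{x_2}\end{pmatrix}\begin{pmatrix}\alpha_1\\ \alpha_2\end{pmatrix}=0,\qquad \mathbf x=(x_1,x_2)\in\mathbb R^2,$$ is $$\begin{pmatrix}\alpha_1(0,\mathbf x)\\ \alpha_2(0,\mathbf x)\end{pmatrix}=\chi(\hat{\mathbf n}\cdot\mathbf x)\,g(\hat{\mathbf t}\cdot\mathbf x)\begin{pmatrix}\cos\frac{\theta}{2}\\ \mathrm i\sin\frac{\theta}{2}\end{pmatrix},$$ then the solution is the localized traveling wave $$\begin{pmatrix}\alpha_1(t,\mathbf x)\\ \alpha_2(t,\mathbf x)\end{pmatrix}=\chi(\hat{\mathbf n}\cdot\mathbf x)\,g(\hat{\mathbf t}\cdot\mathbf x-t)\begin{pmatrix}\cos\frac{\theta}{2}\\ \mathrm i\sin\frac{\theta}{2}\end{pmatrix}.$$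
   Context: Domain wall profile: a piecewise continuous monotonic transition function $m\in L^\infty(\mathbb R)$, real valued, vanishing exactly at $0$ (so that the edge $\{\hat{\mathbf n}\cdot\mathbf x=0\}$ is the zero set of the mass), with $\lim_{u\to\pm\infty}m(u)=\pm m_\infty$ for some $m_\infty>0$, the limits being approached rapidly. The normalization of $\chi$ is $\|\chi\|_{L^2(\mathbb R)}=1$. Writing the equation as $\mathrm i\partial_t\boldsymbol\alpha+\mathcal D\boldsymbol\alpha=0$ with $\mathcal D$ self-adjoint in $L^2(\mathbb R^2;\mathbb C^2)$ (domain $H^1(\mathbb R^2;\mathbb C^2)$), the solution with initial datum $\boldsymbol\alpha_0\in L^2(\mathbb R^2;\mathbb C^2)$ is understood as $\boldsymbol\alpha(t)=e^{\mathrm i\mathcal D t}\boldsymbol\alpha_0$, where $e^{\mathrm i\mathcal D t}$ is the associated unitary group. *)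

(* Defs.v *)
From HB Require Import structures.
From mathcomp Require Import all_boot all_order all_algebra.
From mathcomp Require Import all_classical all_reals all_analysis.
From mathcomp Require Import complex.
Set Implicit Arguments.
Unset Strict Implicit.
Unset Printing Implicit Defensive.
Import Order.TTheory GRing.Theory Num.Theory.
Import numFieldNormedType.Exports.
Local Open Scope classical_set_scope.
Local Open Scope ring_scope.
Local Open Scope complex_scope.

Notation lebesgue1 R := (@lebesgue_measure R).
Notation lebesgue2 R := (@lebesgue_measure R \x @lebesgue_measure R)%E.

Definition piecewise_continuous (R : realType) (m : R -> R) : Prop :=
  (forall a b : R,
     finite_set (`[a, b] `&` [set x | ~ {for x, continuous m}])) /\
  (forall x : R, cvg (m y @[y --> x^'-]) /\ cvg (m y @[y --> x^'+])).

(* "Monotonic" is necessarily nondecreasing, since the limits at -oo and +oo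
   are -minf < 0 < minf. No rate is imposed on the convergence to the limits:
   "approached rapidly" has no fixed quantitative meaning, and leaving it out
   covers every reading of it. *)
Definition domain_wall_profile (R : realType) (m : R -> R) : Prop :=
  [/\ piecewise_continuous m,
      {homo m : x y / x <= y},
      m \in Lfun (lebesgue1 R) +oo%E,
      (forall u : R, m u = 0 <-> u = 0) &
      exists minf : R, [/\ 0 < minf,
        m u @[u --> +oo] --> minf & m u @[u --> -oo] --> - minf]].

(* The oriented integral of f from 0 to u. *)
Definition int0 (R : realType) (f : R -> R) (u : R) : R :=
  if 0 <= u then \int[lebesgue1 R]_(s in `[0, u]) f s
  else - \int[lebesgue1 R]_(s in `[u, 0]) f s.

Definition chi (R : realType) (C : R) (m : R -> R) (u : R) : R :=
  C * expR (- int0 m u).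

Definition ndot (R : realType) (theta : R) (x : R * R) : R :=
  cos theta * x.1 + sin theta * x.2.

Definition tdot (R : realType) (theta : R) (x : R * R) : R :=
  - sin theta * x.1 + cos theta * x.2.

Definition vec2 (R : realType) (a b : R[i]) : 'cV[R[i]]_2 :=
  \col_k (if k == 0 then a else b).

(* Representatives of elements of L^2 spaces are functions, and equality in L^2
   is equality almost everywhere. *)
Notation spinor R := (R * R -> 'cV[R[i]]_2).

Definition L2C d (T : measurableType d) (R : realType)
    (mu : {measure set T -> \bar R}) (f : T -> R[i]) : Prop :=
  (fun x => complex.Re (f x)) \in Lfun mu 2%:E /\
  (fun x => complex.Im (f x)) \in Lfun mu 2%:E.

Definition L2spinor (R : realType) (psi : spinor R) : Prop :=
  forall k : 'I_2, L2C (lebesgue2 R) (fun x => psi x k 0).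

Definition L2norm (R : realType) (psi : spinor R) : \bar R :=
  'N[lebesgue2 R]_2%:E[(fun x => (Num.sqrt (\sum_(k < 2)
    (complex.Re (psi x k 0) ^+ 2 + complex.Im (psi x k 0) ^+ 2)))%:E)].

Definition intC d (T : measurableType d) (R : realType)
    (mu : {measure set T -> \bar R}) (f : T -> R[i]) : R[i] :=
  (\int[mu]_x complex.Re (f x)) +i* (\int[mu]_x complex.Im (f x)).

Definition e1 (R : realType) : R * R := (1, 0).
Definition e2 (R : realType) : R * R := (0, 1).

Fixpoint Cn (R : realType) (n : nat) (f : R * R -> R) : Prop :=
  continuous f /\
  if n is n'.+1 then
    [/\ forall x, derivable f x (e1 R), forall x, derivable f x (e2 R),
        Cn n' ('D_(e1 R) f) & Cn n' ('D_(e2 R) f)]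
  else True.

Definition test_function (R : realType) (f : R * R -> R) : Prop :=
  (forall n, Cn n f) /\ compact (closure [set x | f x != 0]).

(* Real test functions suffice for complex-valued f, by linearity. *)
Definition weak_partial (R : realType) (v : R * R) (f w : R * R -> R[i]) :
    Prop :=
  forall phi : R * R -> R, test_function phi ->
    intC (lebesgue2 R) (fun x => f x * ('D_v phi x)%:C) =
    - intC (lebesgue2 R) (fun x => w x * (phi x)%:C).

(* psi is in H^1(R^2; C^2), with first weak derivatives d1 and d2. *)
Definition H1_with (R : realType) (psi d1 d2 : spinor R) : Prop :=
  [/\ L2spinor psi, L2spinor d1, L2spinor d2 &
      forall k : 'I_2,
        weak_partial (e1 R) (fun x => psi x k 0) (fun x => d1 x k 0) /\
        weak_partial (e2 R) (fun x => psi x k 0) (fun x => d2 x k 0)].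

(* The graph of the Dirac operator D, with domain H^1(R^2; C^2). *)
Definition dirac_graph (R : realType) (theta : R) (m : R -> R)
    (psi phi : spinor R) : Prop :=
  exists d1 d2 : spinor R, H1_with psi d1 d2 /\
    phi = (fun x => vec2
      ('i%C * d2 x 0 0 + ((m (ndot theta x))%:C * psi x 1 0 - d1 x 1 0))
      ((m (ndot theta x))%:C * psi x 0 0 + d1 x 0 0 - 'i%C * d2 x 1 0))
    %[ae lebesgue2 R].

(* Strongly continuous one-parameter groups of unitary operators on
   L^2(R^2; C^2). Each U t is a surjective linear isometry, surjectivity being
   a consequence of the group law; U t f is unconstrained for f outside L^2. *)
Record unitary_group (R : realType) (U : R -> spinor R -> spinor R) : Prop := {
  ug_L2 : forall t f, L2spinor f -> L2spinor (U t f) ;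
  ug_ae : forall t f g, L2spinor f -> L2spinor g ->
    f = g %[ae lebesgue2 R] -> U t f = U t g %[ae lebesgue2 R] ;
  ug_linear : forall t (a : R[i]) f g, L2spinor f -> L2spinor g ->
    U t (a *: f + g) = a *: U t f + U t g %[ae lebesgue2 R] ;
  ug_isometry : forall t f, L2spinor f -> L2norm (U t f) = L2norm f ;
  ug_0 : forall f, L2spinor f -> U 0 f = f %[ae lebesgue2 R] ;
  ug_add : forall s t f, L2spinor f ->
    U (s + t) f = U s (U t f) %[ae lebesgue2 R] ;
  ug_continuous : forall t f, L2spinor f ->
    L2norm (U s f - U t f) @[s --> t] --> 0%E }.

(* The group U is differentiable at 0 on f, with derivative w in L^2. *)
Definition generator (R : realType) (U : R -> spinor R -> spinor R)
    (f w : spinor R) : Prop :=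
  L2norm ((h^-1)%:C *: (U h f - f) - w) @[h --> 0^'] --> 0%E.

(* U t = e^{i A t}, for an operator A given by its graph: by Stone's theorem,
   for self-adjoint A this is the unique strongly continuous unitary group whose
   infinitesimal generator, domain included, is i A. *)
Definition is_exp_group (R : realType) (A : spinor R -> spinor R -> Prop)
    (U : R -> spinor R -> spinor R) : Prop :=
  unitary_group U /\
  forall f w : spinor R, L2spinor f -> L2spinor w ->
    (generator U f w <->
     exists phi, A f phi /\ w = 'i%C *: phi %[ae lebesgue2 R]).

(* Main.v *)
Require Import Defs.
(* A traveling wave chi(n.x) g(t.x) (cos(theta/2), i sin(theta/2)) with g of class
   C^1 lies in H^1, and there the Dirac operator D acts as i d/dg: the terms in
   chi' = - m chi cancel because the constant vector is adapted to the angle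
   theta. Hence s |-> U(s)(wave of g) and s |-> (wave of g translated by s) solve
   the same equation, and since U is unitary the norm of their difference has
   derivative 0, so it vanishes. A rotation of the plane and ||chi|| = 1 give
   ||wave of g|| = ||g||, which makes both sides continuous in g. A general
   continuous g is approximated by its Steklov averages
   (A_h g)(u) = int_0^1 g(u - h s) ds, which are C^1 and converge to g in L^2: they
   converge pointwise by continuity, their norms are at most ||g|| by Jensen and
   Tonelli, and Fatou's lemma upgrades this to convergence in norm. The same
   averages are the difference quotients of a C^1 profile, so they also yield the
   differentiability of the translates in L^2. *)
From HB Require Import structures.
From mathcomp Require Import all_boot all_order all_algebra.
From mathcomp Require Import all_classical all_reals all_analysis.
From mathcomp Require Import measurable_realfun.
From mathcomp Require Import complex ring lra.
Set Implicit Arguments.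
Unset Strict Implicit.
Unset Printing Implicit Defensive.
Import Order.TTheory GRing.Theory Num.Theory.
Import numFieldNormedType.Exports.
Local Open Scope classical_set_scope.
Local Open Scope ring_scope.
Local Open Scope complex_scope.

(** * Affine changes of variables and rotations *)

(** The mass may jump, so [chi] is only known to be Lipschitz and a wave need not be C^1.
    Integration by parts is therefore replaced by difference quotients: translation invariance moves
    the quotient from the test function to the wave, the Lipschitz bound dominates it, and pointwise
    convergence can fail only on the lines where [m] jumps, a null set. Monotonicity of [m] makes
    its primitive convex with minimum at 0, which yields both [chi <= C] and the Lipschitz constant.
    In time, [U] is known only as a unitary group with a given generator. The comparison is made on
    the real function [defect]: unitarity bounds its increment from s to s + k by the distance
    between [U k] and the translation by k, both applied to the traveling wave at time s. Both have
    the derivative [- wave dG] there, so the increment is o(k). The argument also covers times where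
    the distance is 0 and a norm need not be differentiable. *)

Section affine.
Context {R : realType}.
Local Notation mu := (@lebesgue_measure R).
Local Open Scope ereal_scope.

Lemma measurable_affine (a b : R) :
  measurable_fun setT (fun u : R => a * u + b : measurableTypeR R)%R.
Proof.
by apply: measurable_funD => //; apply: measurable_funM.
Qed.

(** Rescaled by [a], the pushforward gives every interval []x, y]] its length, and Lebesgue measure
    is the only measure that does. *)
Lemma pushforward_affine (a b : R) : (0 < a)%R -> forall A, measurable A ->
  pushforward mu (fun u : R => a * u + b : measurableTypeR R)%R A =
  a^-1%:E * mu A.
Proof.
move=> a0 A mA.
pose T := (fun u : R => a * u + b : measurableTypeR R)%R.
pose mu' : {measure set (measurableTypeR R) -> \bar R} :=
  mscale (NngNum (ltW a0)) (pushforward mu T).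
suff : mu A = mu' (measurable_affine a b) A.
  by move=> ->; rewrite /mu' /= /mscale /= muleA -EFinM mulVf ?gt_eqF// mul1e.
apply: lebesgue_measure_unique => // _ [[x y]] _ <-.
rewrite /mu' /= /mscale /= /pushforward.
have -> : T @^-1` [set` `]x, y]] = [set` `](x - b) / a, (y - b) / a]]%R.
  apply/seteqP; split => u /=; rewrite !in_itv/= /T ltr_pdivrMr// ler_pdivlMr// ltrBlDr lerBrDr mulrC//.
rewrite !lebesgue_measure_itv/= !lte_fin ltr_pM2r ?invr_gt0// ltrD2r.
case: ifPn => _; last by rewrite mule0.
rewrite -!EFinD -EFinM; congr EFin; field; exact: lt0r_neq0.
Qed.

Lemma ge0_integral_affine_pos (a b : R) (f : R -> \bar R) : (0 < a)%R ->
  measurable_fun setT f -> (forall u, 0 <= f u) ->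
  \int[mu]_u f (a * u + b)%R = a^-1%:E * \int[mu]_u f u.
Proof.
move=> a0 mf f0.
have ai0 : (0 <= a^-1)%R by rewrite invr_ge0 ltW.
pose T := (fun u : R => a * u + b : measurableTypeR R)%R.
transitivity (\int[pushforward mu T]_u f u).
  by rewrite ge0_integral_pushforward//; exact: measurable_affine.
rewrite -(@ge0_integral_mscale _ _ _ mu setT measurableT (NngNum ai0) f)//.
apply: eq_measure_integral => //=; first exact: measurable_affine.
by move=> mT A mA _; rewrite pushforward_affine.
Qed.

(** A negative slope is turned into a positive one by reflection, which preserves Lebesgue
    measure. *)
Lemma ge0_integral_affine (a b : R) (f : R -> \bar R) : (a != 0)%R ->
  measurable_fun setT f -> (forall u, 0 <= f u) ->
  \int[mu]_u f (a * u + b)%R = `|a|^-1%:E * \int[mu]_u f u.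
Proof.
move=> a0 mf f0.
case: (ltP 0%R a) => [agt0|ale0].
  by rewrite gtr0_norm// ge0_integral_affine_pos.
have alt0 : (a < 0)%R by rewrite lt_neqAle a0.
rewrite ltr0_norm//.
rewrite -(@ge0_integral_affine_pos (- a) b) ?oppr_gt0//.
transitivity (\int[pushforward mu (-%R : _ -> measurableTypeR R)]_u f (- a * u + b)%R).
  rewrite ge0_integral_pushforward//.
    by rewrite preimage_setT; apply: eq_integral => u _ /=; rewrite mulrNN.
  by apply: measurableT_comp => //; exact: measurable_affine.
by apply: eq_measure_integral => A mA _; exact: lebesgue_measureN.
Qed.

Lemma ge0_integral_shift (b : R) (f : R -> \bar R) :
  measurable_fun setT f -> (forall u, 0 <= f u) ->
  \int[mu]_u f (u + b)%R = \int[mu]_u f u.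
Proof.
move=> mf f0; rewrite -[RHS]mul1e -[X in X%:E](@invr1 R) -(@ge0_integral_affine_pos 1 b)//.
by under [in RHS]eq_integral do rewrite mul1r.
Qed.

End affine.

Section plane.
Context {R : realType}.
Local Notation mu := (@lebesgue_measure R).
Local Notation mu2 := (@lebesgue_measure R \x @lebesgue_measure R)%E.
Local Notation RR := (measurableTypeR R).
Local Notation R2 := (measurableTypeR R * measurableTypeR R)%type.

Lemma measurable_ndot (theta : R) :
  measurable_fun [set: R2] (ndot theta : R2 -> RR).
Proof.
by apply: measurable_funD; apply: measurable_funM.
Qed.

Lemma measurable_tdot (theta : R) :
  measurable_fun [set: R2] (tdot theta : R2 -> RR).
Proof.
by apply: measurable_funD; apply: measurable_funM.
Qed.

Local Open Scope ereal_scope.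

Lemma tonelli1 (f : R2 -> \bar R) :
  measurable_fun [set: R2] f -> (forall x, 0 <= f x) ->
  \int[mu2]_x f x = \int[mu]_x \int[mu]_y f (x, y).
Proof. exact: (fubini_tonelli1 (m1 := mu) (m2 := mu)). Qed.

Lemma tonelli2 (f : R2 -> \bar R) :
  measurable_fun [set: R2] f -> (forall x, 0 <= f x) ->
  \int[mu2]_x f x = \int[mu]_y \int[mu]_x f (x, y).
Proof. exact: (fubini_tonelli2 (m1 := mu) (m2 := mu)). Qed.

Lemma ge0_integral_shift2 (p : R * R) (f : R2 -> \bar R) :
  measurable_fun [set: R2] f -> (forall x, 0 <= f x) ->
  \int[mu2]_x f (x + p)%R = \int[mu2]_x f x.
Proof.
move=> mf f0.
have mT : measurable_fun [set: R2] (fun x : R2 => (x + p)%R : R2).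
  by apply: measurable_fun_pair; apply: measurable_funD.
rewrite (tonelli1 mf f0).
transitivity (\int[mu]_x \int[mu]_y f ((x, y) + p)%R).
  by apply: tonelli1 => //; exact: (measurableT_comp mf mT).
rewrite -[RHS](ge0_integral_shift p.1); last 2 first.
- exact: (measurable_fun_fubini_tonelli_F f mf f0).
- by move=> u; exact: integral_ge0.
apply: eq_integral => x _.
rewrite -[RHS](@ge0_integral_shift _ p.2)//.
exact: measurableT_comp.
Qed.

(** Affine substitutions on the line, with Tonelli's theorem between them, do the work of a planar
    change of variables; when the cosine is nonzero their factors [|c|^-1] and [|c|] cancel. *)
Lemma ge0_integral_rotation (theta : R) (p q : R -> \bar R) :
  measurable_fun setT p -> measurable_fun setT q ->
  (forall u, 0 <= p u) -> (forall u, 0 <= q u) ->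
  \int[mu2]_x (p (ndot theta x) * q (tdot theta x)) =
  \int[mu]_u p u * \int[mu]_u q u.
Proof.
move=> mp mq p0 q0.
have Q0 : 0 <= \int[mu]_u q u by exact: integral_ge0.
have mpq : measurable_fun [set: R2] (fun x : R2 => p (ndot theta x) * q (tdot theta x)).
  apply: emeasurable_funM; apply: measurableT_comp => //.
  - exact: measurable_ndot.
  - exact: measurable_tdot.
have cs := cos2Dsin2 theta.
(* When the cosine vanishes, [ndot] depends on the second coordinate alone and [tdot] on the first,
   so the integral separates at once. *)
have [c0|c0] := eqVneq (cos theta) 0%R.
  have s1 : (sin theta ^+ 2 = 1)%R by rewrite -cs c0 expr0n add0r.
  have s0 : sin theta != 0%R by rewrite -sqrf_eq0 s1 oner_eq0.
  have ns : (`|sin theta| = 1)%R by apply/eqP; rewrite -sqr_norm_eq1 s1.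
  rewrite tonelli2//; last by move=> x; exact: mule_ge0.
  rewrite /ndot /tdot/= c0.
  transitivity (\int[mu]_y (p (sin theta * y + 0)%R * \int[mu]_u q u)).
    apply: eq_integral => y _.
    under eq_integral do rewrite !mul0r add0r addr0.
    rewrite ge0_integralZl//; last first.
      by apply: measurableT_comp => //; exact: measurable_funM.
    rewrite addr0; congr (_ * _).
    under eq_integral do rewrite -[(_ * _)%R]addr0.
    by rewrite ge0_integral_affine ?oppr_eq0// normrN ns invr1 mul1e.
  rewrite ge0_integralZr//; last first.
    by apply: measurableT_comp => //; exact: measurable_affine.
  by rewrite ge0_integral_affine// ns invr1 mul1e.
set c := cos theta in c0 cs *; set s := sin theta in cs *.
(* Solving [u = c x + s y] for x turns [tdot] into [c^-1 y - (s / c) u], because [c^2 + s^2 = 1];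
   [h] is the integrand in the coordinates y and u. *)
pose h (y u : R) := p u * q (c^-1 * y + (- s / c * u))%R.
have mh : measurable_fun [set: R2] (fun z : R2 => h z.2 z.1).
  apply: emeasurable_funM; apply: measurableT_comp => //.
  by apply: measurable_funD; apply: measurable_funM.
rewrite tonelli2//; last by move=> x; exact: mule_ge0.
transitivity (\int[mu]_y (`|c|^-1%:E * \int[mu]_u h y u)).
  apply: eq_integral => y _.
  rewrite -(@ge0_integral_affine _ c (s * y) (h y))//; last 2 first.
  - exact: (measurable_fun_pair1 y mh).
  - by move=> u; exact: mule_ge0.
  apply: eq_integral => x _; rewrite /h /ndot /tdot/= -/c -/s.
  congr (_ * q _).
  transitivity (c^-1 * (c ^+ 2 + s ^+ 2) * y + - s / c * (c * x + s * y))%R.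
    by field.
  by rewrite cs mulr1.
rewrite ge0_integralZl//; last 2 first.
- exact: (measurable_fun_fubini_tonelli_G (m1 := mu) (fun z => h z.2 z.1) mh
    (fun z => mule_ge0 (p0 z.1) (q0 _))).
- by move=> y _; apply: integral_ge0 => u _; exact: mule_ge0.
have -> : \int[mu]_y \int[mu]_u h y u = \int[mu]_u \int[mu]_y h y u.
  by rewrite -(tonelli2 mh (fun z => mule_ge0 (p0 z.1) (q0 _)))
    (tonelli1 mh (fun z => mule_ge0 (p0 z.1) (q0 _))).
have -> : \int[mu]_u \int[mu]_y h y u =
    \int[mu]_u (p u * (`|c|%:E * \int[mu]_v q v)).
  apply: eq_integral => u _; rewrite ge0_integralZl//; last first.
    by apply: measurableT_comp => //; exact: measurable_affine.
  by rewrite ge0_integral_affine ?invr_eq0// normfV invrK.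
rewrite ge0_integralZr//; last by rewrite mule_ge0.
rewrite muleCA; congr (_ * _).
by rewrite muleA -EFinM mulVf ?normr_eq0// mul1e.
Qed.

Lemma integral_shift2 (p : R * R) (f : R2 -> R) :
  measurable_fun [set: R2] f ->
  (\int[mu2]_x f (x + p)%R = \int[mu2]_x f x)%R.
Proof.
move=> mf; rewrite /Rintegral; congr fine.
rewrite [LHS]integralE [RHS]integralE; congr (_ - _).
- have mp : measurable_fun [set: R2] (EFin \o f)^\+.
    exact/measurable_funepos/measurable_EFinP.
  rewrite -(ge0_integral_shift2 p mp (funepos_ge0 _)).
  by apply: eq_integral => x _; rewrite !funeposE.
- have mn : measurable_fun [set: R2] (EFin \o f)^\-.
    exact/measurable_funeneg/measurable_EFinP.
  rewrite -(ge0_integral_shift2 p mn (funeneg_ge0 _)).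
  by apply: eq_integral => x _; rewrite !funenegE.
Qed.

(** The rotation formula with second factor 1 gives [mu N] times the infinite length of the line,
    and 0 times [+oo] is 0. It serves with [N] the set of discontinuities of [m]. *)
Lemma negligible_ndot (theta : R) (N : set R) :
  measurable N -> mu N = 0 -> mu2.-negligible [set x : R2 | N (ndot theta x)].
Proof.
move=> mN N0.
have mN2 : measurable (ndot theta @^-1` N : set R2).
  by rewrite -[X in measurable X]setTI; exact: measurable_ndot.
apply/negligibleP => //.
transitivity (\int[mu2]_x (((\1_N (ndot theta x))%:E : \bar R) * 1)).
  transitivity (\int[mu2]_x (\1_(ndot theta @^-1` N : set R2) x)%:E).
    by rewrite integral_indic// setIT.
  by apply: eq_integral => x _; rewrite mule1.
rewrite (@ge0_integral_rotation theta (fun u => (\1_N u)%:E) (cst 1))//.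
  by rewrite integral_indic// setIT [X in X * _](N0 : _ = 0) mul0e.
exact/measurable_EFinP.
Qed.

End plane.

(** * Steklov averages in L^2 *)

Section fatou_square.
Context d (T : measurableType d) (R : realType).
Variable mu : {measure set T -> \bar R}.
Local Open Scope ereal_scope.

Lemma limn_einf_gt (u : (\bar R)^nat) (a : \bar R) : a < limn_einf u ->
  \forall n \near \oo, a < u n.
Proof.
rewrite limn_einf_lim (cvg_lim _ (@cvg_einfs_sup _ u))//.
move=> /ereal_sup_gt[_ [n _ <-]] an; exists n => // k /= nk.
by apply: (lt_le_trans an); apply: ereal_inf_lbound; exists k.
Qed.

(** The parallelogram identity gives [a n + b n <= 4 I], where [a n] and [b n] integrate the squares
    of [h n + f] and [h n - f]. Fatou's lemma on the first square bounds the lower limit of [a n]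
    below by [4 I], which leaves no room for [b n]. *)
Lemma fatou_square (h : (T -> R)^nat) (f : T -> R) :
  (forall n, measurable_fun setT (h n)) -> measurable_fun setT f ->
  \int[mu]_x (f x ^+ 2)%:E < +oo ->
  (forall n, \int[mu]_x (h n x ^+ 2)%:E <= \int[mu]_x (f x ^+ 2)%:E) ->
  (forall x, h n x @[n --> \oo] --> f x)%R ->
  \int[mu]_x ((h n x - f x) ^+ 2)%:E @[n --> \oo] --> 0.
Proof.
move=> mh mf fy hf hcvg.
have sq0 (k : T -> R) : 0 <= \int[mu]_x (k x ^+ 2)%:E.
  by apply: integral_ge0 => x _; rewrite lee_fin sqr_ge0.
have msq (k : T -> R) : measurable_fun setT k ->
    measurable_fun setT (fun x => (k x ^+ 2)%:E).
  by move=> mk; apply/measurable_EFinP; exact: measurable_funX.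
set I := \int[mu]_x (f x ^+ 2)%:E in fy hf *.
have Ifin : I \is a fin_num by rewrite ge0_fin_numE// sq0.
pose a n := \int[mu]_x ((h n x + f x) ^+ 2)%:E.
pose b n := \int[mu]_x ((h n x - f x) ^+ 2)%:E.
have mD n : measurable_fun setT (fun x => h n x + f x)%R by exact: measurable_funD.
have mB n : measurable_fun setT (fun x => h n x - f x)%R by exact: measurable_funB.
have ab n : a n + b n <= 4%R%:E * I.
  rewrite /a /b -ge0_integralD//; last 4 first.
  - by move=> x _; rewrite lee_fin sqr_ge0.
  - exact: msq.
  - by move=> x _; rewrite lee_fin sqr_ge0.
  - exact: msq.
  under eq_integral => x _.
    rewrite -EFinD.
    have -> : ((h n x + f x) ^+ 2 + (h n x - f x) ^+ 2 =
      2 * h n x ^+ 2 + 2 * f x ^+ 2)%R by ring.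
    have -> : (2 * h n x ^+ 2 + 2 * f x ^+ 2)%:E = 2%R%:E * (h n x ^+ 2)%:E + 2%R%:E * (f x ^+ 2)%:E by rewrite -!EFinM.
  over.
  rewrite ge0_integralD//; last 4 first.
  - by move=> x _; rewrite -EFinM lee_fin mulr_ge0// sqr_ge0.
  - by apply: emeasurable_funM => //; exact: msq.
  - by move=> x _; rewrite -EFinM lee_fin mulr_ge0// sqr_ge0.
  - by apply: emeasurable_funM => //; exact: msq.
  rewrite !ge0_integralZl//; try by [exact: msq|move=> x _; rewrite lee_fin sqr_ge0].
  apply: (@le_trans _ _ (2%R%:E * I + 2%R%:E * I)).
    by rewrite leeD2r// lee_wpmul2l.
  rewrite -(fineK Ifin) -!EFinM -EFinD lee_fin; lra.
have liminf : 4%R%:E * I <= limn_einf a.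
  have -> : 4%R%:E * I = \int[mu]_x limn_einf (fun n => ((h n x + f x) ^+ 2)%:E).
    rewrite -ge0_integralZl//; last 2 first.
    - exact: msq.
    - by move=> x _; rewrite lee_fin sqr_ge0.
    apply: eq_integral => x _.
    have hc : (((h n x + f x) ^+ 2)%:E @[n --> \oo] --> ((f x + f x) ^+ 2)%:E).
      apply: cvg_EFin; first by apply: nearW.
      apply: (@cvg_comp _ _ _ (fun n => h n x + f x)%R (fun z => z ^+ 2)%R); last exact: exprn_continuous.
      by apply: cvgD => //; exact: cvg_cst.
    have [-> _] := cvg_limn_einf_sup hc.
    by rewrite -EFinM; congr EFin; ring.
  apply: fatou => // [n|n x _]; first exact: msq.
  by rewrite lee_fin sqr_ge0.
have bfin n : b n \is a fin_num.
  rewrite ge0_fin_numE; last exact: sq0.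
  apply: le_lt_trans (_ : 4%R%:E * I < +oo); last by rewrite lte_mul_pinfty.
  by apply: le_trans (ab n); rewrite leeDr// sq0.
have afin n : a n \is a fin_num.
  rewrite ge0_fin_numE; last exact: sq0.
  apply: le_lt_trans (_ : 4%R%:E * I < +oo); last by rewrite lte_mul_pinfty.
  by apply: le_trans (ab n); rewrite leeDl// sq0.
apply/fine_cvgP; split; first by apply: nearW => n; exact: bfin.
apply/cvgr0Pnorm_lt => e e0.
have : (4 * fine I - e)%:E < limn_einf a.
  apply: lt_le_trans liminf; rewrite -(fineK Ifin) -EFinM lte_fin/=; lra.
move=> /limn_einf_gt; apply: filterS => n.
have := ab n; have := sq0 (fun x => h n x - f x)%R; rewrite -/(b n).
rewrite -(fineK (bfin n)) -(fineK (afin n)) -(fineK Ifin) -EFinM -EFinD !lee_fin lte_fin.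
by move=> b0 abI aI /=; rewrite ger0_norm//; lra.
Qed.

End fatou_square.

(** * Primitives and the fundamental theorem of calculus *)

Section primitive.
Context {R : realType}.
Local Notation mu := (@lebesgue_measure R).
Implicit Types f G : R -> R.

Lemma is_derive_affine (a b x : R) : is_derive x 1 (fun s : R => b + a * s) a.
Proof.
have -> : (fun s : R => b + a * s) = cst b + a *: (id : R -> R) by apply/funext.
have := is_deriveD (is_derive_cst b x 1) (is_deriveZ a (is_derive_id x 1)).
by move/is_derive_eq; apply; rewrite add0r; exact: mulr1.
Qed.

Lemma is_derive_continuous f df (x : R) : is_derive x 1 f df -> {for x, continuous f}.
Proof. by move=> [/derivable1_diffP/differentiable_continuous]. Qed.

Lemma continuous_integrable_itv f (a b : R) : continuous f ->
  mu.-integrable `[a, b] (EFin \o f).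
Proof.
move=> cf; apply: (@continuous_compact_integrable R f).
  exact: segment_compact.
exact: continuous_subspaceT.
Qed.

Section int0.
Variable f : R -> R.
Hypothesis fi : forall a b : R, mu.-integrable `[a, b] (EFin \o f).

Lemma Rintegral_itv_split (a b c : R) : a <= b -> b <= c ->
  \int[mu]_(s in `[a, c]) f s =
  \int[mu]_(s in `[a, b]) f s + \int[mu]_(s in `[b, c]) f s.
Proof.
move=> ab bc; rewrite -[X in _ = _ + X]Rintegral_itv_obnd_cbnd; last first.
  by apply: integrableS (fi b c) => //; apply: subset_itvr; rewrite bnd_simp.
by rewrite -(@Rintegral_itvB _ f (BLeft a) (BRight c) b (fi a c)) ?bnd_simp// addrC subrK.
Qed.

Lemma int0B (a b : R) : a <= b -> int0 f b - int0 f a = \int[mu]_(s in `[a, b]) f s.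
Proof.
move=> ab; rewrite /int0; case: (leP 0 b) => b0; case: (leP 0 a) => a0.
- by rewrite (Rintegral_itv_split a0 ab); ring.
- by rewrite (Rintegral_itv_split (ltW a0) b0); ring.
- by have := le_lt_trans (le_trans a0 ab) b0; rewrite ltxx.
- by rewrite (Rintegral_itv_split ab (ltW b0)); ring.
Qed.

(** Continuity is asked at [x] alone, so that the lemma applies to [m] away from its jumps. Near
    [x], [int0 f] differs by the constant [int0 f a] from the integral based at a point [a] to the
    left of [x]. *)
Lemma is_derive_int0 (x : R) : {for x, continuous f} -> is_derive x 1 (int0 f) (f x).
Proof.
move=> cf; pose a := Num.min x 0 - 1.
have ax : a < x by rewrite /a ltrBlDr gt_min ltrDl ltr01.
have x1 : x < x + 1 by rewrite ltrDl.
have [dF F'] := @continuous_FTC1_closed R f a x (x + 1) x1 (fi a (x + 1)) ax cf.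
have dF2 : is_derive x 1 (fun y => \int[mu]_(s in `[a, y]) f s + int0 f a) (f x).
  have : is_derive x 1 (fun y => \int[mu]_(s in `[a, y]) f s) (f x).
    exact: (DeriveDef dF (etrans (esym (derive1E _ _)) F')).
  by move=> ?; apply: is_derive_eq; rewrite addr0.
apply: near_eq_is_derive dF2.
near=> y.
by rewrite -int0B ?subrK//; apply: ltW; near: y; exact: lt_nbhsr.
Unshelve. all: by end_near. Qed.

End int0.

Lemma FTC2 (G f : R -> R) (a b : R) : a < b -> continuous f ->
  (forall x : R, is_derive x 1 G (f x)) ->
  \int[mu]_(s in `[a, b]) f s = G b - G a.
Proof.
move=> ab cf dG; have cG : continuous G by move=> x; exact: is_derive_continuous.
rewrite /Rintegral (@continuous_FTC2 _ f G)//.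
- exact: continuous_subspaceT.
- split; [by move=> x _; have [] := dG x|exact/cvg_at_right_filter/cG|exact/cvg_at_left_filter/cG].
- by move=> x _; rewrite derive1E derive_val.
Qed.

End primitive.

Section average.
Context {R : realType}.
Local Notation mu := (@lebesgue_measure R).
Implicit Types f G : R -> R.

(** The Steklov average, rescaled to the fixed interval [0, 1]: the formula then makes sense for [k]
    of either sign and gives back [f] at [k = 0]. *)
Definition avg (k : R) f (u : R) : R := \int[mu]_(s in `[0, 1]) f (u - k * s).

Lemma continuous_shift_scale f (u k : R) : continuous f ->
  continuous (fun s => f (u - k * s)).
Proof.
move=> cf s; apply: (@continuous_comp _ _ _ (fun s => u - k * s) f); last exact: cf.
have := is_derive_affine (- k) u s.
by under eq_fun do rewrite mulNr; exact: is_derive_continuous.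
Qed.

(** The fundamental theorem of calculus along [s |-> G (u - k * s)]. With [G = int0 f] it
    differentiates the average of [f]; with [G] a C^1 profile it turns its difference quotient into
    an average of its derivative. *)
Lemma avg_primitive f G (k u : R) : continuous f ->
  (forall x : R, is_derive x 1 G (f x)) -> k * avg k f u = G u - G (u - k).
Proof.
move=> cf dG.
have cfk := @continuous_shift_scale f u k cf.
have dH (s : R) : is_derive s 1 (fun s => G (u - k * s)) (f (u - k * s) * (- k)).
  apply: (@is_derive1_comp _ G (fun s => u - k * s)).
  by have := is_derive_affine (- k) u s; under eq_fun do rewrite mulNr.
have cfkN : continuous (fun s => f (u - k * s) * (- k)).
  by move=> s; apply: cvgM; [exact: cfk|exact: cvg_cst].
have := FTC2 ltr01 cfkN dH.
rewrite RintegralZr//; last exact: continuous_integrable_itv.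
rewrite mulr0 subr0 mulr1 -/(avg k f u) => avgE.
by rewrite -[RHS]opprB -avgE mulrN opprK mulrC.
Qed.

Lemma Rintegral01_cst (c : R) : \int[mu]_(s in `[0, 1]) c = c.
Proof.
rewrite Rintegral_cst//= [X in fine X](_ : _ = 1%E) ?mulr1//.
by rewrite [LHS](lebesgue_measure_itv `[0, 1]) /= lte01 oppr0 adde0.
Qed.

Lemma avg0 f u : avg 0 f u = f u.
Proof.
rewrite /avg; under eq_Rintegral do rewrite mul0r subr0.
exact: Rintegral01_cst.
Qed.

Lemma continuous_integrable f : continuous f ->
  forall a b : R, mu.-integrable `[a, b] (EFin \o f).
Proof. by move=> cf a b; exact: continuous_integrable_itv. Qed.

Lemma is_derive_avg f (k u : R) : continuous f -> k != 0 ->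
  is_derive u 1 (avg k f) (k^-1 * (f u - f (u - k))).
Proof.
move=> cf k0.
have dF (x : R) := is_derive_int0 (continuous_integrable cf) (cf x).
have -> : avg k f = k^-1 *: ((int0 f) - (fun v => int0 f (- k + 1 * v))).
  apply/funext => v; rewrite -[LHS](mulKf k0) (@avg_primitive f _ k v cf dF).
  by rewrite -[RHS]/(k^-1 * (int0 f v - int0 f (- k + 1 * v))) mul1r (addrC (- k)).
have dFk : is_derive u 1 (fun v => int0 f (- k + 1 * v)) (f (u - k) * 1).
  apply: (@is_derive1_comp _ (int0 f) (fun v => - k + 1 * v)).
    by rewrite mul1r (addrC (- k)); exact: dF.
  exact: is_derive_affine.
have := is_deriveZ k^-1 (is_deriveB (dF u) dFk).
by rewrite mulr1.
Qed.

Lemma continuous_avg f (k : R) : continuous f -> continuous (avg k f).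
Proof.
move=> cf; have [->|k0] := eqVneq k 0.
  have -> // : avg 0 f = f by apply/funext => u; exact: avg0.
by move=> u; exact: (is_derive_continuous (is_derive_avg u cf k0)).
Qed.

Lemma avg_cvg f (u : R) (k : R^nat) : continuous f ->
  k n @[n --> \oo] --> 0 -> avg (k n) f u @[n --> \oo] --> f u.
Proof.
move=> cf k0; apply/cvgrPdist_le => e e0.
have /cvgrPdist_le /(_ e e0) := cf u.
move=> -[d /= d0 fd].
have : \forall n \near \oo, `|k n| < d by move/cvgr0Pnorm_lt : k0; exact.
apply: filterS => n knd.
have cfk := @continuous_shift_scale f u (k n) cf.
have -> : f u - avg (k n) f u = \int[mu]_(s in `[0, 1]) (f u - f (u - k n * s)).
  rewrite RintegralB//; last 2 first.
  - by apply: continuous_integrable_itv => ?; exact: cvg_cst.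
  - exact: continuous_integrable_itv.
  by rewrite Rintegral01_cst.
have cB : continuous (fun s => f u - f (u - k n * s)).
  by move=> s; apply: cvgB; [exact: cvg_cst|exact: cfk].
have iB := continuous_integrable_itv 0 1 cB.
apply: le_trans (le_normr_Rintegral _ iB) _ => //.
apply: (@le_trans _ _ (\int[mu]_(s in `[0, 1]) e)); last first.
  by rewrite Rintegral01_cst.
apply: le_Rintegral => //.
- exact: (integrable_norm iB).
- by apply: continuous_integrable_itv => ?; exact: cvg_cst.
move=> s /=; rewrite in_itv/= => /andP[s0 s1].
apply: fd; rewrite /= opprB addrC subrK normrM (ger0_norm s0).
by apply: le_lt_trans knd; rewrite ler_piMr.
Qed.

End average.

Section average_L2.
Context {R : realType}.
Local Notation mu := (@lebesgue_measure R).
Implicit Types f : R -> R.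

(** Nonnegativity of the variance: since [0, 1] has length 1, the integral of [(f - c)^2], with [c]
    the mean of [f], is the integral of [f^2] minus [c^2]. *)
Lemma jensen_sqr01 f : continuous f ->
  (\int[mu]_(s in `[0, 1]) f s) ^+ 2 <= \int[mu]_(s in `[0, 1]) (f s ^+ 2).
Proof.
move=> cf; set c := \int[mu]_(s in `[0, 1]) f s.
have c2 : continuous (fun s => f s ^+ 2).
  by move=> s; apply: (@continuous_comp _ _ _ f (fun z => z ^+ 2)); [exact: cf|exact: exprn_continuous].
have c1 : continuous (fun s => 2 * c * f s).
  by move=> s; apply: cvgM; [exact: cvg_cst|exact: cf].
have c12 : continuous (fun s => f s ^+ 2 - 2 * c * f s).
  by move=> s; apply: cvgB; [exact: c2|exact: c1].
have cc : continuous (fun _ : R => c ^+ 2) by exact: cst_continuous.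
have ci := @continuous_integrable_itv R.
have : 0 <= \int[mu]_(s in `[0, 1]) ((f s - c) ^+ 2).
  by apply: Rintegral_ge0 => s _; exact: sqr_ge0.
under eq_Rintegral.
  move=> s _; have -> : (f s - c) ^+ 2 = f s ^+ 2 - 2 * c * f s + c ^+ 2 by ring.
  over.
rewrite RintegralD//; [|exact: ci|exact: ci].
rewrite RintegralB//; [|exact: ci|exact: ci].
rewrite RintegralZl//; last exact: ci.
rewrite Rintegral01_cst -/c; nra.
Qed.

Local Open Scope ereal_scope.

Lemma avg_L2 f (k : R) : continuous f ->
  \int[mu]_u ((avg k f u) ^+ 2)%:E <= \int[mu]_u ((f u) ^+ 2)%:E.
Proof.
move=> cf.
have mf : measurable_fun setT f by exact: continuous_measurable_fun.
pose F (z : measurableTypeR R * measurableTypeR R) : \bar R :=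
  ((f (z.1 - k * z.2)) ^+ 2 * \1_`[0%R, 1%R] z.2)%:E.
have F0 z : 0 <= F z by rewrite lee_fin mulr_ge0// sqr_ge0.
have mF : measurable_fun setT F.
  apply/measurable_EFinP; apply: measurable_funM.
    apply: measurable_funX; apply: measurableT_comp => //.
    by apply: measurable_funB => //; apply: measurable_funM.
  by apply: measurableT_comp.
have le1 : \int[mu]_u ((avg k f u) ^+ 2)%:E <= \int[mu]_u \int[mu]_s F (u, s).
  apply: ge0_le_integral => //.
  - by move=> u _; rewrite lee_fin sqr_ge0.
  - apply/measurable_EFinP; apply: measurable_funX.
    by apply: continuous_measurable_fun; exact: continuous_avg.
  - exact: (measurable_fun_fubini_tonelli_F F mF F0).
  move=> u _.
  have cfk := @continuous_shift_scale _ f u k cf.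
  have c2 : continuous (fun s => f (u - k * s) ^+ 2)%R.
    move=> s; apply: (@continuous_comp _ _ _ (fun s => f (u - k * s)%R) (fun z => z ^+ 2)%R).
      exact: cfk.
    exact: exprn_continuous.
  apply: (@le_trans _ _ (\int[mu]_(s in `[0%R, 1%R]) (f (u - k * s) ^+ 2)%:E)).
    rewrite -[leRHS]fineK; last first.
      by apply: integrable_fin_num => //; exact: continuous_integrable_itv.
    by rewrite lee_fin; exact: jensen_sqr01.
  rewrite [leLHS]integral_mkcond.
  apply: ge0_le_integral => //.
  - by move=> s _; rewrite erestrict_ge0// => x _; rewrite lee_fin sqr_ge0.
  - apply/(measurable_restrictT _ _).1 => //; apply/measurable_EFinP.
    by apply: measurable_funTS; exact: continuous_measurable_fun.
  - exact: (measurable_fun_pair2 u mF).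
  - move=> s _; rewrite /F/= patchE indicE; case: ifPn => _; by rewrite ?mulr1 ?mulr0.
apply: le_trans le1 _.
rewrite -(tonelli1 mF F0) (tonelli2 mF F0).
(* For each fixed s the inner integral is that of a translate of [f ^+ 2], so it does not depend on
   s; the indicator then contributes the length 1. *)
have -> : \int[mu]_s \int[mu]_u F (u, s) =
    \int[mu]_s ((\1_`[0%R, 1%R] s)%:E * \int[mu]_u ((f u) ^+ 2)%:E).
  apply: eq_integral => s _; rewrite /F /=.
  under eq_integral do rewrite mulrC EFinM.
  have mf2 (b : R) : measurable_fun setT (fun u : R => (f (u - b) ^+ 2)%:E).
    apply/measurable_EFinP; apply: measurable_funX; apply: measurableT_comp => //.
    exact: measurable_funB.
  rewrite ge0_integralZl//; last 2 first.
  - exact: mf2.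
  - by move=> u _; rewrite lee_fin sqr_ge0.
  congr (_ * _).
  apply: (@ge0_integral_shift R (- (k * s)) (fun u : R => (f u ^+ 2)%:E)).
    by apply/measurable_EFinP; exact: measurable_funX.
  by move=> u; rewrite lee_fin sqr_ge0.
have I0 : 0 <= \int[mu]_u ((f u) ^+ 2)%:E.
  by apply: integral_ge0 => u _; rewrite lee_fin sqr_ge0.
rewrite ge0_integralZr//; last by apply/measurable_EFinP.
rewrite integral_indic// setIT.
by rewrite [X in X * _](lebesgue_measure_itv `[0%R, 1%R]) /= lte01 oppr0 adde0 mul1e.
Qed.

Lemma avg_L2_cvg f : continuous f -> \int[mu]_u ((f u) ^+ 2)%:E < +oo ->
  (fine (\int[mu]_u ((avg k f u - f u) ^+ 2)%:E) @[k --> 0^'] --> 0)%R.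
Proof.
(* The convergence lemma derived from Fatou is about sequences, so the limit at 0 is tested along
   sequences of nonzero steps. *)
move=> cf fy; apply/cvgr_dnbhsP => k [_ k0].
have : \int[mu]_u ((avg (k n) f u - f u) ^+ 2)%:E @[n --> \oo] --> 0.
  apply: fatou_square => //.
  - by move=> n; apply: continuous_measurable_fun; exact: continuous_avg.
  - exact: continuous_measurable_fun.
  - by move=> n; exact: avg_L2.
  - by move=> u; exact: avg_cvg.
by move/fine_cvgP => [].
Qed.

End average_L2.

(** * The profile chi *)

Section wall.
Context {R : realType}.
Local Notation mu := (@lebesgue_measure R).

(** For [p <= q], factor out [expR (- p) <= 1] and apply [1 + x <= expR x] at [x = p - q]. *)
Lemma expRN_lipschitz (p q : R) : 0 <= p -> 0 <= q ->
  `|expR (- p) - expR (- q)| <= `|p - q|.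
Proof.
wlog pq : p q / p <= q.
  move=> H p0 q0; case: (leP p q) => [pq|/ltW qp]; first exact: H.
  by rewrite distrC (distrC p); exact: H.
move=> p0 q0; rewrite ger0_norm; last by rewrite subr_ge0 ler_expR lerN2.
rewrite ler0_norm ?subr_le0// opprB.
have -> : - q = - p + (p - q) by ring.
rewrite expRD -[X in X - _]mulr1 -mulrBr.
have h1 : expR (- p) <= 1 by rewrite expR_le1 oppr_le0.
have h2 : 0 <= 1 - expR (p - q) by rewrite subr_ge0 expR_le1 subr_le0.
have h3 := expR_ge1Dx (p - q).
by apply: le_trans (ler_wpM2r h2 h1) _; rewrite mul1r; lra.
Qed.

Variable m : R -> R.
Hypothesis hm : domain_wall_profile m.

Lemma wall_homo : {homo m : x y / x <= y}.
Proof. by case: hm. Qed.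

Lemma wall0 : m 0 = 0.
Proof. by case: hm => _ _ _ h _; exact/h. Qed.

(** A bound at every point, not only almost everywhere: by monotonicity each value lies between
    values taken far out on either side, and these are within 1 of the limits. *)
Lemma wall_bounded : exists2 B : R, 0 < B & forall u, `|m u| <= B.
Proof.
case: hm => _ mle _ _ [minf [m0 mp mn]].
have ub u : m u <= minf + 1.
  have /cvgrPdist_le /(_ 1 ltr01) mp1 := mp.
  near (+oo : set_system R) => v.
  have uv : u <= v by near: v; apply: nbhs_pinfty_ge; rewrite num_real.
  apply: le_trans (mle _ _ uv) _.
  have : `|minf - m v| <= 1 by near: v.
  by rewrite ler_norml => /andP[]; lra.
have lb u : - (minf + 1) <= m u.
  have /cvgrPdist_le /(_ 1 ltr01) mn1 := mn.
  near (-oo : set_system R) => v.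
  have uv : v <= u by near: v; apply: nbhs_ninfty_le; rewrite num_real.
  apply: le_trans (mle _ _ uv).
  have : `|- minf - m v| <= 1 by near: v.
  by rewrite ler_norml => /andP[]; lra.
exists (minf + 1); first lra.
by move=> u; rewrite ler_norml lb ub.
Unshelve. all: by end_near. Qed.

Lemma measurable_wall : measurable_fun setT m.
Proof.
by apply: nondecreasing_measurable => // x y; exact: wall_homo.
Qed.

Lemma wall_integrable (a b : R) : mu.-integrable `[a, b] (EFin \o m).
Proof.
have [B B0 mB] := wall_bounded.
apply: measurable_bounded_integrable => //.
- exact/compact_finite_measure/segment_compact.
- by apply: measurable_funTS; exact: measurable_wall.
- by exists B; split; [exact: num_real|move=> x Bx y _; apply: le_trans (mB y) (ltW Bx)].
Qed.

Let Rintegral_itv_cst (a b c : R) : a <= b -> \int[mu]_(s in `[a, b]) c = c * (b - a).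
Proof.
move=> ab; rewrite Rintegral_cst//= [X in fine X](_ : _ = (b - a)%:E)//.
rewrite [LHS](lebesgue_measure_itv `[a, b])/= lte_fin.
case: ltP => // ba; have -> : a = b by apply/le_anti; rewrite ab ba.
by rewrite subrr.
Qed.

(* The primitive of a nondecreasing function is convex, with subgradient m. *)
Lemma wall_subgradient (u v : R) : m u * (v - u) <= int0 m v - int0 m u.
Proof.
have icst (c a b : R) : mu.-integrable `[a, b] (EFin \o (fun _ : R => c)).
  by apply: continuous_integrable_itv; exact: cst_continuous.
case: (leP u v) => [uv|/ltW vu].
  rewrite (int0B wall_integrable uv) -Rintegral_itv_cst//.
  apply: le_Rintegral => //; [exact: wall_integrable|].
  by move=> x /=; rewrite in_itv/= => /andP[ux _]; exact: wall_homo.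
rewrite -opprB mulrN -[leRHS]opprB lerN2 (int0B wall_integrable vu) -Rintegral_itv_cst//.
apply: le_Rintegral => //; [exact: wall_integrable|].
by move=> x /=; rewrite in_itv/= => /andP[_ xu]; exact: wall_homo.
Qed.

(** The convex primitive has subgradient [m 0 = 0] at the origin, so its minimum is its value 0
    there. *)
Lemma int0_wall_ge0 (u : R) : 0 <= int0 m u.
Proof.
have := wall_subgradient 0 u; rewrite wall0 mul0r.
have -> : int0 m 0 = 0 by rewrite /int0 lexx set_itv1 Rintegral_set1.
by rewrite subr0.
Qed.

Variables (C : R).
Hypothesis C0 : 0 < C.

Lemma chi_ge0 (u : R) : 0 <= chi C m u.
Proof. by rewrite /chi mulr_ge0 ?expR_ge0// ltW. Qed.

Lemma chi_le (u : R) : chi C m u <= C.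
Proof.
by rewrite /chi -[leRHS]mulr1 ler_pM2l// expR_le1 oppr_le0 int0_wall_ge0.
Qed.

(** This replaces differentiability, which may fail where [m] jumps, as the source of a bound on
    difference quotients. *)
Lemma chi_lipschitz : exists2 L : R, 0 < L &
  forall u v, `|chi C m v - chi C m u| <= L * `|v - u|.
Proof.
have [B B0 mB] := wall_bounded.
exists (C * B); first exact: mulr_gt0.
move=> u v; rewrite /chi -mulrBr normrM gtr0_norm// -mulrA ler_pM2l//.
apply: le_trans (expRN_lipschitz (int0_wall_ge0 v) (int0_wall_ge0 u)) _.
(* The subgradients at [u] and [v] enclose the increment of [int0 m] between [m u * (v - u)] and
   [m v * (v - u)]. *)
have h1 := wall_subgradient u v; have h2 := wall_subgradient v u.
have bd w : `|m w * (v - u)| <= B * `|v - u| by rewrite normrM ler_wpM2r.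
have := bd u; have := bd v; rewrite !ler_norml => /andP[b1 b2] /andP[b3 b4].
apply/andP; split; nra.
Qed.

Lemma continuous_chi : continuous (chi C m).
Proof.
have [L L0 chiL] := chi_lipschitz.
move=> u; apply/cvgrPdist_le => e e0.
near=> v; rewrite distrC; apply: le_trans (chiL u v) _.
rewrite -ler_pdivlMl// mulrC distrC; near: v.
apply: cvgr_dist_le; [exact: cvg_id|exact: divr_gt0].
Unshelve. all: by end_near. Qed.

Lemma is_derive_chi (u : R) : {for u, continuous m} ->
  is_derive u 1 (chi C m) (- m u * chi C m u).
Proof.
move=> cm; have dM := is_derive_int0 wall_integrable cm.
have dN := is_deriveN dM.
have dE : is_derive u 1 (expR \o (- int0 m)) (expR (- int0 m u) * - m u).
  by apply: is_derive1_comp.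
have := is_deriveZ C dE.
move/is_derive_eq; apply; rewrite /chi.
by transitivity (C * (expR (- int0 m u) * - m u)) => //; ring.
Qed.

Lemma wall_discontinuity_countable : countable [set x | ~ {for x, continuous m}].
Proof.
case: hm => -[fin _] _ _ _ _.
have -> : [set x | ~ {for x, continuous m}] =
    \bigcup_n (`[- n%:R, n%:R] `&` [set x | ~ {for x, continuous m}]).
  apply/seteqP; split => [x xm|x [n _ []]//].
  exists (Num.bound `|x|) => //; split=> //=.
  by rewrite in_itv/= -ler_norml; apply/ltW; exact: archi_boundP.
apply: bigcup_countable => // n _; apply: finite_set_countable; exact: fin.
Qed.

End wall.

(** * Weak derivatives *)

Section plane_topology.
Context {R : realType}.
Local Notation mu := (@lebesgue_measure R).
Local Notation mu2 := (@lebesgue_measure R \x @lebesgue_measure R)%E.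
Local Notation RR := (measurableTypeR R).
Local Notation R2 := (measurableTypeR R * measurableTypeR R)%type.

Definition rat_rect (p : (rat * rat) * (rat * rat)) : set R2 :=
  `]ratr p.1.1, ratr p.1.2[ `*` `]ratr p.2.1, ratr p.2.2[.

(** The sigma-algebra of the plane is the product one, so an open set is written as the countable
    union of the rectangles with rational corners that it contains; the other rectangles are
    replaced by [set0]. *)
Lemma open_measurable2 (O : set (R * R)) : open O -> measurable (O : set R2).
Proof.
move=> oO.
have -> : (O : set R2) =
    \bigcup_p (if `[< rat_rect p `<=` O >] then rat_rect p else set0).
  apply/seteqP; split => [z Oz|z [p _]]; last by case: asboolP => // pO /pO.
  have /nbhs_ballP[e /= e0 eO] := open_nbhs_nbhs (conj oO Oz).
  have l (x : R) : exists q : rat, x - e < ratr q < x.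
    by have [|q] := @rat_in_itvoo R (x - e) x; [rewrite ltrBlDr ltrDl|rewrite in_itv/=; exists q].
  have r (x : R) : exists q : rat, x < ratr q < x + e.
    by have [|q] := @rat_in_itvoo R x (x + e); [rewrite ltrDl|rewrite in_itv/=; exists q].
  have [a /andP[a1 a2]] := l z.1; have [b /andP[b1 b2]] := r z.1.
  have [c /andP[c1 c2]] := l z.2; have [d /andP[d1 d2]] := r z.2.
  exists ((a, b), (c, d)) => //; case: asboolP => [_|]; last first.
    case; move=> y [/=]; rewrite !in_itv/= => /andP[y1 y2] /andP[y3 y4].
    apply: eO; split; rewrite /ball/= ltr_norml; apply/andP; split; lra.
  by split; rewrite /= in_itv/=; apply/andP.
apply: countable_bigcupT_measurable; first exact: countableP.
move=> p; case: ifPn => _; last exact: measurable0.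
exact: measurableX.
Qed.

Lemma continuous_measurable2 (f : R * R -> R) : continuous f ->
  measurable_fun [set: R2] f.
Proof.
move=> /continuousP cf; apply: (measurability _ (RGenOpens.measurableE R)).
move=> _ [_ [a [b ->] <-]]; rewrite setTI; apply: open_measurable2.
exact/cf/interval_open.
Qed.

Definition box (B : R) : set (R * R) := `[- B, B] `*` `[- B, B].

Lemma boxP (B : R) (x : R * R) : box B x <-> `|x| <= B.
Proof.
rewrite prod_normE/= ge_max !ler_norml /box/=; split.
  by move=> [/=]; rewrite !in_itv/= => -> ->.
by move=> /andP[h1 h2]; split; rewrite /= in_itv.
Qed.

Lemma compact_box (B : R) : compact (box B).
Proof. by apply: compact_setX; exact: segment_compact. Qed.

Lemma measurable_box (B : R) : measurable (box B : set R2).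
Proof. exact: measurableX. Qed.

Lemma continuous_box_bounded (f : R * R -> R) (B : R) : continuous f ->
  exists2 M : R, 0 <= M & forall x, `|x| <= B -> `|f x| <= M.
Proof.
move=> cf.
have : compact (f @` box B).
  by apply: continuous_compact; [exact: continuous_subspaceT|exact: compact_box].
move=> /compact_bounded[M [_ Mf]].
exists (`|M| + 1); first by rewrite addr_ge0.
move=> x xB; apply: (Mf (`|M| + 1)); first by rewrite ltr_pwDr// ler_norm.
by exists x => //; exact/boxP.
Qed.

Lemma integrable_box (g : R2 -> R) (B M : R) : measurable_fun [set: R2] g ->
  0 <= M -> (forall x, `|g x| <= M * \1_(box B) x) ->
  mu2.-integrable setT (EFin \o g).
Proof.
move=> mg M0 gM.
have ib : mu2.-integrable setT (fun x => (M * \1_(box B) x)%:E).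
  have mb := measurable_box B.
  have : mu2.-integrable setT (fun x => (\1_(box B) x : R)%:E).
    apply/integrableP; split; first by apply/measurable_EFinP.
    under eq_integral do rewrite gee0_abs ?lee_fin//.
    rewrite integral_indic// setIT.
    rewrite [X in (X < _)%E]product_measure1E//.
    have fb : (mu `[(- B)%R, B]%classic < +oo)%E.
      exact/compact_finite_measure/segment_compact.
    by apply: lte_mul_pinfty => //; rewrite ge0_fin_numE.
  by move=> /(integrableZl measurableT M).
apply: le_integrable ib => //; first exact/measurable_EFinP.
by move=> x _; rewrite /= lee_fin (le_trans (gM x))// ler_norm.
Qed.

End plane_topology.

Section weak_derivative.
Context {R : realType}.
Local Notation mu := (@lebesgue_measure R).
Local Notation mu2 := (@lebesgue_measure R \x @lebesgue_measure R)%E.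
Local Notation RR := (measurableTypeR R).
Local Notation R2 := (measurableTypeR R * measurableTypeR R)%type.

Lemma is_derive_line (f : R * R -> R) (x v : R * R) (s : R) :
  derivable f (x + s *: v) v ->
  is_derive s 1 (fun s => f (x + s *: v)) ('D_v f (x + s *: v)).
Proof.
have E : (fun h : R => h^-1 *: (((fun s => f (x + s *: v)) \o shift s) (h *: 1) - f (x + s *: v)))
   = (fun h : R => h^-1 *: ((f \o shift (x + s *: v)) (h *: v) - f (x + s *: v))).
  apply/funext => h /=; do 3 f_equal.
  by rewrite [h *: 1]mulr1 scalerDl addrCA.
by move=> df; split; rewrite /derivable /derive E.
Qed.

Lemma derive_quotient_cvg (f : R * R -> R) (x v : R * R) (k : R^nat) :
  derivable f x v -> (forall n, k n != 0) -> k n @[n --> \oo] --> 0 ->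
  (k n)^-1 * (f (x + k n *: v) - f x) @[n --> \oo] --> 'D_v f x.
Proof.
move=> df kn0 k0.
have /cvgr_dnbhsP/(_ k (conj kn0 k0)) := df.
by apply: cvg_trans; apply: near_eq_cvg; apply: nearW => n /=; rewrite (addrC x).
Qed.

Variables (v : R * R) (f w phi : R * R -> R).
Hypothesis v1 : `|v| <= 1.
Hypothesis cf : continuous f.
Hypothesis mw : measurable_fun [set: R2] w.
Hypothesis f_lip : forall B : R, exists2 L : R, 0 <= L &
  forall (x : R * R) (k : R), `|x| <= B -> 0 < k <= 1 ->
    `|f (x - k *: v) - f x| <= L * k.
Let k (n : nat) : R := n.+1%:R^-1.
Hypothesis f_cvg : {ae mu2, forall x : R2,
  (k n)^-1 * (f (x - k n *: v) - f x) @[n --> \oo] --> - w x}.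
Hypothesis cphi : continuous phi.
Hypothesis dphi : forall x, derivable phi x v.
Hypothesis cdphi : continuous ('D_v phi).
Hypothesis phi_supp : compact (closure [set x | phi x != 0]).

Let k_gt0 n : 0 < k n. Proof. by rewrite /k invr_gt0. Qed.
Let k_le1 n : k n <= 1. Proof. by rewrite /k invf_le1// ler1n. Qed.
Let k_neq0 n : k n != 0. Proof. by rewrite gt_eqF. Qed.
Let k_cvg0 : k n @[n --> \oo] --> 0. Proof. exact: cvg_harmonic. Qed.
Let kv_le1 n : `|k n *: v| <= 1.
Proof. by rewrite normrZ gtr0_norm// mulr_ile1// ltW. Qed.

Let phi_box : exists2 B : R, 0 <= B & forall x, B < `|x| -> phi x = 0.
Proof.
have [M [_ Mphi]] := compact_bounded phi_supp.
exists (`|M| + 1); first by rewrite addr_ge0.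
move=> x xM; apply/eqP; apply: contraTT xM => px; rewrite -leNgt.
by apply: Mphi; [rewrite ltr_pwDr// ler_norm|exact: subset_closure].
Qed.

Let mshift (p : R * R) : measurable_fun [set: R2] (fun x : R2 => (x + p)%R : R2).
Proof. by apply: measurable_fun_pair; apply: measurable_funD. Qed.

Let mf : measurable_fun [set: R2] f. Proof. exact: continuous_measurable2. Qed.
Let mphi : measurable_fun [set: R2] phi. Proof. exact: continuous_measurable2. Qed.
Let mdphi : measurable_fun [set: R2] ('D_v phi). Proof. exact: continuous_measurable2. Qed.

Let A n (x : R2) : R := f x * ((k n)^-1 * (phi (x + k n *: v) - phi x)).
Let B n (x : R2) : R := (k n)^-1 * (f (x - k n *: v) - f x) * phi x.

Let mA n : measurable_fun [set: R2] (A n).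
Proof.
apply: measurable_funM => //; apply: measurable_funM => //; apply: measurable_funB => //.
exact: (measurableT_comp mphi (mshift _)).
Qed.

Let mB n : measurable_fun [set: R2] (B n).
Proof.
apply: measurable_funM => //; apply: measurable_funM => //; apply: measurable_funB => //.
exact: (measurableT_comp mf (mshift _)).
Qed.

Let A_bound : exists (b M : R), 0 <= M /\ forall n x, `|A n x| <= M * \1_(box b) x.
Proof.
have [b b0 pb] := phi_box.
(* A step [k n *: v] has norm at most 1. Outside the box of radius [b + 1] both [x] and the shifted
   point are therefore off the support of [phi]; inside it, the intermediate point of the mean value
   theorem stays within radius [b + 2]. *)
have [Mf Mf0 fM] := continuous_box_bounded (b + 1) cf.
have [Md Md0 dM] := continuous_box_bounded (b + 2) cdphi.
exists (b + 1), (Mf * Md); split; first exact: mulr_ge0.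
move=> n x; rewrite indicE; case: (boolP (x \in box (b + 1))) => xb; last first.
  have {}xb : b + 1 < `|x|.
    by rewrite ltNge; apply: contraNN xb => xb; rewrite inE; exact/boxP.
  rewrite /A !pb ?subrr ?mulr0 ?normr0//; last first.
    have := ler_normB (x + k n *: v) (k n *: v); rewrite addrK; have := kv_le1 n; lra.
  by apply: le_lt_trans xb; rewrite lerDl.
have {}xb : `|x| <= b + 1 by move: xb; rewrite inE => /boxP.
rewrite mulr1 /A normrM; apply: ler_pM => //; first exact: fM.
have [|c /[!in_itv]/= /andP[c0 ck]] := @MVT R (fun s => phi (x + s *: v)) (fun s => 'D_v phi (x + s *: v)) 0 (k n) (k_gt0 n) (fun s _ => @is_derive_line phi x v s (@dphi (x + s *: v))).
  apply: continuous_subspaceT => s; apply: is_derive_continuous.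
  exact: is_derive_line.
rewrite scale0r addr0 subr0 => ->.
rewrite mulrC -mulrA mulfV// mulr1; apply: dM.
apply: le_trans (ler_normD _ _) _.
have : `|c *: v| <= 1.
  by rewrite normrZ gtr0_norm// mulr_ile1// ?(ltW c0)// ltW// (lt_le_trans ck).
lra.
Qed.

Let B_bound : exists (b M : R), 0 <= M /\ forall n x, `|B n x| <= M * \1_(box b) x.
Proof.
have [b b0 pb] := phi_box.
have [Mp Mp0 pM] := continuous_box_bounded b cphi.
have [L L0 fL] := f_lip b.
exists b, (L * Mp); split; first exact: mulr_ge0.
move=> n x; rewrite indicE; case: (boolP (x \in box b)) => xb; last first.
  have {}xb : b < `|x|.
    by rewrite ltNge; apply: contraNN xb => xb; rewrite inE; exact/boxP.
  by rewrite /B pb// !mulr0 normr0.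
have {}xb : `|x| <= b by move: xb; rewrite inE => /boxP.
rewrite mulr1 /B normrM; apply: ler_pM => //; last exact: pM.
rewrite normrM gtr0_norm ?invr_gt0// ler_pdivrMl// mulrC.
by apply: fL => //; rewrite k_gt0 k_le1.
Qed.

Let iA n : mu2.-integrable setT (EFin \o A n).
Proof.
have [b [M [M0 AM]]] := A_bound; exact: (integrable_box (mA n) M0 (AM n)).
Qed.

Let iB n : mu2.-integrable setT (EFin \o B n).
Proof.
have [b [M [M0 BM]]] := B_bound; exact: (integrable_box (mB n) M0 (BM n)).
Qed.

(* Translation invariance of the Lebesgue measure moves the difference quotient
   from phi to f. *)
Let AB n : \int[mu2]_x A n x = \int[mu2]_x B n x.
Proof.
have [b b0 pb] := phi_box.
have [Mp Mp0 pM] := continuous_box_bounded b cphi.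
have [Mf Mf0 fM] := continuous_box_bounded b cf.
have ifp : mu2.-integrable setT (EFin \o (fun x : R2 => (k n)^-1 * (f x * phi x))).
  apply: (@integrable_box _ _ b ((k n)^-1 * (Mf * Mp))).
  - by apply: measurable_funM => //; exact: measurable_funM.
  - by rewrite !mulr_ge0// invr_ge0 ltW.
  move=> x; rewrite indicE; case: (boolP (x \in box b)) => xb; last first.
    have {}xb : b < `|x|.
      by rewrite ltNge; apply: contraNN xb => xb; rewrite inE; exact/boxP.
    by rewrite pb// !mulr0 normr0.
  have {}xb : `|x| <= b by move: xb; rewrite inE => /boxP.
  rewrite mulr1 normrM gtr0_norm ?invr_gt0// ler_pM2l ?invr_gt0// normrM.
  by apply: ler_pM => //; [exact: fM|exact: pM].
(* Adding [f phi / k] leaves [f x * phi (x + k v) / k] on one side and [f (x - k v) * phi x / k] on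
   the other, which are translates of each other. *)
have -> : \int[mu2]_x A n x =
    \int[mu2]_x ((A n x + (k n)^-1 * (f x * phi x)) - (k n)^-1 * (f x * phi x)).
  by apply: eq_Rintegral => x _; rewrite addrK.
have -> : \int[mu2]_x B n x =
    \int[mu2]_x ((B n x + (k n)^-1 * (f x * phi x)) - (k n)^-1 * (f x * phi x)).
  by apply: eq_Rintegral => x _; rewrite addrK.
rewrite RintegralB//; last exact: (integrableD _ (iA n) ifp).
rewrite RintegralB//; last exact: (integrableD _ (iB n) ifp).
congr (_ - _).
have mG : measurable_fun [set: R2] (fun x => B n x + (k n)^-1 * (f x * phi x)).
  by apply: measurable_funD => //; apply: measurable_funM => //; exact: measurable_funM.
rewrite -(integral_shift2 (k n *: v) mG); apply: eq_Rintegral => x _.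
by rewrite /A /B addrK; ring.
Qed.

(** [A n] puts the difference quotient on [phi] and tends to [f * 'D_v phi]; [B n] puts it on [f],
    with a backward step, and tends almost everywhere to [- w * phi]. Their integrals agree for
    every n, and both sequences are dominated by a multiple of the indicator of a box. *)
Lemma weak_derivativeR : \int[mu2]_x (f x * 'D_v phi x) = - \int[mu2]_x (w x * phi x).
Proof.
have [bA [MA [MA0 AM]]] := A_bound; have [bB [MB [MB0 BM]]] := B_bound.
have ind (b M : R) : 0 <= M -> mu2.-integrable setT (fun x => (M * \1_(box b) x)%:E).
  move=> M0; apply: (@integrable_box _ _ b M) => //.
  - by apply: measurable_funM => //; apply: measurable_indic; exact: measurable_box.
  - by move=> x; rewrite ger0_norm// mulr_ge0.
have [iD _ cA] : [/\ mu2.-integrable setT (fun x => (f x * 'D_v phi x)%:E), 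
    \int[mu2]_x `|(A n x)%:E - (f x * 'D_v phi x)%:E| @[n --> \oo] --> 0 &
    \int[mu2]_x (A n x)%:E @[n --> \oo] --> \int[mu2]_x (f x * 'D_v phi x)%:E]%E.
  apply: (@dominated_convergence _ _ _ mu2 setT measurableT
    (fun n x => (A n x)%:E) _ (fun x => (MA * \1_(box bA) x)%:E)) => //.
  - by move=> n; apply/measurable_EFinP.
  - by apply/measurable_EFinP; exact: measurable_funM.
  - apply: aeW => x _; apply: cvg_EFin; first exact: nearW.
    by apply: cvgM; [exact: cvg_cst|exact: derive_quotient_cvg].
  - exact: ind.
  - by apply: aeW => x n _; rewrite lee_fin.
have [iw _ cB] : [/\ mu2.-integrable setT (fun x => (- w x * phi x)%:E), 
    \int[mu2]_x `|(B n x)%:E - (- w x * phi x)%:E| @[n --> \oo] --> 0 &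
    \int[mu2]_x (B n x)%:E @[n --> \oo] --> \int[mu2]_x (- w x * phi x)%:E]%E.
  apply: (@dominated_convergence _ _ _ mu2 setT measurableT
    (fun n x => (B n x)%:E) _ (fun x => (MB * \1_(box bB) x)%:E)) => //.
  - by move=> n; apply/measurable_EFinP.
  - apply/measurable_EFinP; apply: measurable_funM => //; exact: measurable_funN.
  - apply: filterS f_cvg => x fx _; apply: cvg_EFin; first exact: nearW.
    by apply: cvgM => //; exact: cvg_cst.
  - exact: ind.
  - by apply: aeW => x n _; rewrite lee_fin.
have AB' n : (\int[mu2]_x (A n x)%:E = \int[mu2]_x (B n x)%:E)%E.
  rewrite -[LHS]fineK; last exact: (integrable_fin_num _ (iA n)).
  rewrite -[RHS]fineK; last exact: (integrable_fin_num _ (iB n)).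
  congr EFin; exact: AB.
have E : (\int[mu2]_x (f x * 'D_v phi x)%:E = \int[mu2]_x (- w x * phi x)%:E)%E.
  move: cA; rewrite (funext AB') => cA.
  exact: (cvg_unique (@ereal_hausdorff R) cA cB).
rewrite {1}/Rintegral E -/(Rintegral mu2 setT (fun x => - w x * phi x)).
have -> : \int[mu2]_x (w x * phi x) = \int[mu2]_x (-1 * (- w x * phi x)).
  by apply: eq_Rintegral => x _; ring.
by rewrite RintegralZl// mulN1r opprK.
Qed.

End weak_derivative.

(** * Real scalar modes: Lipschitz bounds and weak derivatives *)

Section real_mode.
Context {R : realType}.
Local Notation mu := (@lebesgue_measure R).
Local Notation mu2 := (@lebesgue_measure R \x @lebesgue_measure R)%E.
Local Notation RR := (measurableTypeR R).
Local Notation R2 := (measurableTypeR R * measurableTypeR R)%type.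

Lemma continuous_itv_bounded (a : R -> R) (B : R) : continuous a ->
  exists2 M : R, 0 <= M & forall x, `|x| <= B -> `|a x| <= M.
Proof.
move=> ca.
have : compact (a @` `[- B, B]).
  by apply: continuous_compact; [exact: continuous_subspaceT|exact: segment_compact].
move=> /compact_bounded[M [_ Mf]].
exists (`|M| + 1); first by rewrite addr_ge0.
move=> x xB; apply: (Mf (`|M| + 1)); first by rewrite ltr_pwDr// ler_norm.
by exists x => //=; rewrite in_itv/= -ler_norml.
Qed.

Lemma C1_locally_lipschitz (a da : R -> R) (B : R) : continuous da ->
  (forall x : R, is_derive x 1 a (da x)) ->
  exists2 L : R, 0 <= L &
    forall x y, `|x| <= B -> `|y| <= B -> `|a y - a x| <= L * `|y - x|.
Proof.
move=> cda dera; have [L L0 daL] := continuous_itv_bounded B cda.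
exists L => // x y; wlog xy : x y / x <= y.
  move=> H xB yB; case: (leP x y) => [xy|/ltW yx]; first exact: H.
  by rewrite distrC (distrC y); exact: H.
move=> xB yB.
have ca : {within `[x, y], continuous a}.
  by apply: continuous_subspaceT => z; exact: (is_derive_continuous (dera z)).
have [c /[!in_itv]/= /andP[xc cy] ->] := MVT_segment xy (fun z _ => dera z) ca.
rewrite normrM ler_wpM2r//; apply: daL.
by move: xB yB; rewrite !ler_norml => /andP[? ?] /andP[? ?]; apply/andP; split; lra.
Qed.

Lemma ndotD (theta : R) (x y : R * R) : ndot theta (x + y) = ndot theta x + ndot theta y.
Proof. by rewrite /ndot/=; ring. Qed.

Lemma tdotD (theta : R) (x y : R * R) : tdot theta (x + y) = tdot theta x + tdot theta y.
Proof. by rewrite /tdot/=; ring. Qed.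

Lemma ndotZ (theta k : R) (x : R * R) : ndot theta (k *: x) = k * ndot theta x.
Proof.
rewrite -[LHS]/(cos theta * (k * x.1) + sin theta * (k * x.2)) /ndot; ring.
Qed.

Lemma tdotZ (theta k : R) (x : R * R) : tdot theta (k *: x) = k * tdot theta x.
Proof.
rewrite -[LHS]/(- sin theta * (k * x.1) + cos theta * (k * x.2)) /tdot; ring.
Qed.

(** The plane carries the maximum norm, so each of the two coordinates contributes at most [B]. *)
Lemma tdot_le (theta : R) (x : R * R) (B : R) : `|x| <= B -> `|tdot theta x| <= 2 * B.
Proof.
rewrite prod_normE/= ge_max => /andP[x1 x2].
rewrite /tdot (le_trans (ler_normD _ _))// !normrM normrN.
have s1 : `|sin theta| <= 1 by rewrite ler_norml sin_geN1 sin_le1.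
have c1 : `|cos theta| <= 1 by rewrite ler_norml cos_geN1 cos_le1.
have := ler_pM (normr_ge0 _) (normr_ge0 _) s1 x1.
have := ler_pM (normr_ge0 _) (normr_ge0 _) c1 x2.
lra.
Qed.

Lemma continuous_ndot (theta : R) : continuous (ndot theta : R * R -> R).
Proof.
move=> x; apply: cvgD; apply: cvgM; try exact: cvg_cst.
  exact: cvg_fst.
exact: cvg_snd.
Qed.

Lemma continuous_tdot (theta : R) : continuous (tdot theta : R * R -> R).
Proof.
move=> x; apply: cvgD; apply: cvgM; try exact: cvg_cst.
  exact: cvg_fst.
exact: cvg_snd.
Qed.

Section wall.
Variables (theta : R) (m : R -> R) (C : R).
Hypotheses (hm : domain_wall_profile m) (C0 : 0 < C).

Definition mode (a : R -> R) (x : R * R) : R := chi C m (ndot theta x) * a (tdot theta x).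

(** The product rule in direction [v] with [chi' = - m chi]. The formula is used everywhere,
    including on the lines where [m] jumps and the classical derivative may not exist. *)
Definition dmode (v : R * R) (a da : R -> R) (x : R * R) : R :=
  ndot theta v * (- m (ndot theta x)) * mode a x + tdot theta v * mode da x.

Lemma continuous_mode (a : R -> R) : continuous a -> continuous (mode a).
Proof.
move=> ca x; apply: cvgM.
  apply: (@continuous_comp _ _ _ (ndot theta) (chi C m)); first exact: continuous_ndot.
  exact: (continuous_chi hm C0).
apply: (@continuous_comp _ _ _ (tdot theta) a); first exact: continuous_tdot.
exact: ca.
Qed.

Lemma measurable_dmode (v : R * R) (a da : R -> R) : continuous a -> continuous da ->
  measurable_fun [set: R2] (dmode v a da).
Proof.
move=> ca cda; apply: measurable_funD; apply: measurable_funM => //.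
- apply: measurable_funM => //; apply: measurable_funN.
  exact: (measurableT_comp (measurable_wall hm) (@measurable_ndot R theta)).
- by apply: continuous_measurable2; exact: continuous_mode.
- by apply: continuous_measurable2; exact: continuous_mode.
Qed.

Lemma mode_lipschitz (v : R * R) (a da : R -> R) (B : R) : continuous da ->
  (forall x : R, is_derive x 1 a (da x)) ->
  exists2 L : R, 0 <= L & forall (x : R * R) (k : R), `|x| <= B -> 0 < k <= 1 ->
    `|mode a (x - k *: v) - mode a x| <= L * k.
Proof.
move=> cda dera.
have ca : continuous a by move=> x; exact: (is_derive_continuous (dera x)).
set p := ndot theta v; set q := tdot theta v.
have [L1 L10 chiL] := chi_lipschitz hm C0.
(* For [|x| <= B] the coordinate [tdot theta x] is at most [2 * B] in absolute value, and a step
   [k <= 1] moves it by at most [|q|]. *)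
have [L2 L20 aL] := C1_locally_lipschitz (2 * B + `|q|) cda dera.
have [M M0 aM] := continuous_itv_bounded (2 * B + `|q|) ca.
exists (L1 * `|p| * M + C * (L2 * `|q|)).
  by rewrite addr_ge0// !mulr_ge0// ltW.
move=> x k xB /andP[k0 k1].
rewrite -[- (k *: v)]scaleNr /mode ndotD tdotD ndotZ tdotZ -/p -/q.
set y := ndot theta x; set z := tdot theta x.
have zB : `|z| <= 2 * B by exact: tdot_le.
have kr (r : R) : `|- k * r| = k * `|r| by rewrite normrM normrN (gtr0_norm k0).
have kq := kr q; have kp := kr p.
have q0 := normr_ge0 q.
have z'B : `|z + - k * q| <= 2 * B + `|q|.
  by rewrite (le_trans (ler_normD _ _))// kq; nra.
have split4 (r1 r2 s1 s2 : R) :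
  r1 * s1 - r2 * s2 = (r1 - r2) * s1 + r2 * (s1 - s2) by ring.
rewrite split4.
rewrite (le_trans (ler_normD _ _))// [leRHS]mulrDl; apply: lerD; rewrite normrM.
  have h1 : `|chi C m (y + - k * p) - chi C m y| <= L1 * (k * `|p|).
    by have := chiL y (y + - k * p); rewrite (addrC y) addrK kp.
  have := ler_pM (normr_ge0 _) (normr_ge0 _) h1 (aM _ z'B).
  by move/le_trans; apply; rewrite le_eqVlt; apply/orP; left; apply/eqP; ring.
have h1 : `|a (z + - k * q) - a z| <= L2 * (k * `|q|).
  have := aL z (z + - k * q); rewrite [X in L2 * `|X|](_ : _ = - k * q) ?kq; last by rewrite (addrC z) addrK.
  apply => //.
  by apply: le_trans zB _; rewrite lerDl.
have h2 : `|chi C m y| <= C by rewrite ger0_norm ?chi_ge0// chi_le.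
have := ler_pM (normr_ge0 _) (normr_ge0 _) h2 h1.
by move/le_trans; apply; rewrite le_eqVlt; apply/orP; left; apply/eqP; ring.
Qed.

Lemma mode_quotient_cvg (v : R * R) (a da : R -> R) (x : R * R) (k : R^nat) :
  (forall x : R, is_derive x 1 a (da x)) ->
  {for ndot theta x, continuous m} ->
  (forall n, k n != 0) -> k n @[n --> \oo] --> 0 ->
  (k n)^-1 * (mode a (x - k n *: v) - mode a x) @[n --> \oo] --> - dmode v a da x.
Proof.
move=> dera cm kn0 k0.
set p := ndot theta v; set q := tdot theta v.
set y := ndot theta x in cm *; set z := tdot theta x.
(* [X] and [Y] are the two factors of the mode along the line [x - h *: v], so the quotient becomes
   a derivative at 0 in one variable. *)
pose X (h : R) := chi C m (y + - p * h); pose Y (h : R) := a (z + - q * h).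
have dX : is_derive (0 : R) 1 X (- m y * chi C m y * - p).
  apply: (@is_derive1_comp _ (chi C m) (fun h => y + - p * h)); last exact: is_derive_affine.
  by rewrite mulr0 addr0; exact: is_derive_chi.
have dY : is_derive (0 : R) 1 Y (da z * - q).
  apply: (@is_derive1_comp _ a (fun h => z + - q * h)); last exact: is_derive_affine.
  by rewrite mulr0 addr0; exact: dera.
have [dXY XY] := is_deriveM dX dY.
have := dXY; rewrite /derivable => /cvg_ex[l].
have E : (fun h : R => h^-1 *: (((X * Y) \o shift (0 : R)) (h *: 1) - (X * Y) 0)) =
         (fun h : R => h^-1 * (mode a (x - h *: v) - mode a x)).
  apply/funext => h; rewrite /= addr0 [h *: 1]mulr1.
  rewrite -[LHS]/(h^-1 * (X h * Y h - X 0 * Y 0)) /X /Y !mulr0 !addr0.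
  rewrite -[- (h *: v)]scaleNr /mode ndotD tdotD ndotZ tdotZ -/p -/q -/y -/z.
  by rewrite !mulNr !(mulrC h).
rewrite E => hl.
have -> : - dmode v a da x = l.
  have : 'D_1 (X * Y) 0 = l by rewrite /derive E; exact/cvg_lim.
  rewrite XY => <-; rewrite /dmode /mode -/p -/q -/y -/z /X /Y !mulr0 !addr0.
  rewrite -[RHS]/(chi C m y * (da z * - q) + a z * (- m y * chi C m y * - p)); ring.
by move/cvgr_dnbhsP : hl; apply.
Qed.

Lemma mode_weak_derivative (v : R * R) (a da : R -> R) (phi : R * R -> R) :
  `|v| <= 1 -> continuous da -> (forall x : R, is_derive x 1 a (da x)) ->
  continuous phi -> (forall x, derivable phi x v) -> continuous ('D_v phi) ->
  compact (closure [set x | phi x != 0]) ->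
  \int[mu2]_x (mode a x * 'D_v phi x) = - \int[mu2]_x (dmode v a da x * phi x).
Proof.
move=> v1 cda dera cphi dphi cdphi sphi.
have ca : continuous a by move=> x; exact: (is_derive_continuous (dera x)).
apply: weak_derivativeR => //.
- exact: continuous_mode.
- exact: measurable_dmode.
- by move=> B; exact: mode_lipschitz cda dera.
(* The quotients can fail to converge only where [ndot theta x] is a discontinuity of [m]: countably
   many lines, hence a null set. *)
have cN := wall_discontinuity_countable hm.
have N2 := negligible_ndot theta (countable_measurable (fun t : R => measurable_set1 t) cN) (countable_lebesgue_measure0 cN).
apply: negligibleS N2 => x /= xN cm; apply: xN.
apply: mode_quotient_cvg => //; exact: cvg_harmonic.
Qed.

End wall.
End real_mode.

(** * Norms of spinors *)

Section Lnorm2.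
Context d (T : measurableType d) (R : realType).
Variable mu : {measure set T -> \bar R}.
Local Open Scope ereal_scope.

Lemma Lnorm2E (f : T -> R) :
  'N[mu]_2%R%:E[EFin \o f] = (\int[mu]_x (f x ^+ 2)%:E) `^ 2^-1.
Proof.
rewrite unlock; congr (_ `^ _); apply: eq_integral => x _.
by rewrite /= powR_mulrn// -normrX ger0_norm// sqr_ge0.
Qed.

Lemma Lfun2P (f : T -> R) : f \in Lfun mu 2%R%:E <->
  measurable_fun setT f /\ \int[mu]_x (f x ^+ 2)%:E < +oo.
Proof.
rewrite inE; split.
  move=> /andP[/[!inE]/= mf]; rewrite /finite_norm Lnorm2E => /lty_poweRy f2.
  by split => //; apply: f2; rewrite invr_eq0.
move=> [mf f2]; apply/andP; split; rewrite inE//=.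
by rewrite /finite_norm Lnorm2E poweR_lty.
Qed.

Lemma le_Lnorm2 (f g : T -> R) : measurable_fun setT f -> measurable_fun setT g ->
  (forall x, 0 <= f x <= g x)%R ->
  'N[mu]_2%R%:E[EFin \o f] <= 'N[mu]_2%R%:E[EFin \o g].
Proof.
move=> mf mg fg; rewrite !Lnorm2E.
have f0 : 0 <= \int[mu]_x (f x ^+ 2)%:E.
  by apply: integral_ge0 => x _; rewrite lee_fin sqr_ge0.
have g0 : 0 <= \int[mu]_x (g x ^+ 2)%:E.
  by apply: integral_ge0 => x _; rewrite lee_fin sqr_ge0.
apply: gt0_ler_poweR; rewrite ?in_itv/= ?leey ?f0 ?g0//.
apply: ge0_le_integral => //.
- by move=> x _; rewrite lee_fin sqr_ge0.
- by apply/measurable_EFinP; exact: measurable_funX.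
- by apply/measurable_EFinP; exact: measurable_funX.
- move=> x _; rewrite lee_fin; have /andP[f0x fgx] := fg x.
  by rewrite ler_sqr ?nnegrE// (le_trans f0x).
Qed.

Lemma Lfun2D (f g : T -> R) : f \in Lfun mu 2%R%:E -> g \in Lfun mu 2%R%:E ->
  (fun x => f x + g x)%R \in Lfun mu 2%R%:E.
Proof.
have := @Lfun_addr_closed _ _ _ mu 2%R%:E; rewrite lee_fin ler1n => /(_ isT)[_ LD].
exact: LD.
Qed.

Lemma Lfun2M_bounded (h f : T -> R) (B : R) : measurable_fun setT h ->
  (forall x, `|h x| <= B)%R -> f \in Lfun mu 2%R%:E ->
  (fun x => h x * f x)%R \in Lfun mu 2%R%:E.
Proof.
move=> mh hB /Lfun2P[mf fy]; apply/Lfun2P; split; first exact: measurable_funM.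
apply: (@le_lt_trans _ _ (\int[mu]_x ((B ^+ 2)%:E * (f x ^+ 2)%:E))).
  apply: ge0_le_integral => //.
  - by move=> x _; rewrite lee_fin sqr_ge0.
  - by apply/measurable_EFinP/measurable_funX; exact: measurable_funM.
  - by apply/measurable_EFinP; apply: measurable_funM => //; exact: measurable_funX.
  - move=> x _; rewrite -EFinM lee_fin exprMn ler_wpM2r ?sqr_ge0//.
    by rewrite -[leLHS]real_normK ?num_real// lerXn2r ?nnegrE// (le_trans _ (hB x)).
rewrite ge0_integralZl//.
- by apply: lte_mul_pinfty => //; rewrite lee_fin sqr_ge0.
- by apply/measurable_EFinP; exact: measurable_funX.
- by move=> x _; rewrite lee_fin sqr_ge0.
- by rewrite lee_fin sqr_ge0.
Qed.

Lemma Lfun2Z (r : R) (f : T -> R) : f \in Lfun mu 2%R%:E ->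
  (fun x => r * f x)%R \in Lfun mu 2%R%:E.
Proof. exact: (@Lfun2M_bounded (fun _ => r) f `|r|%R). Qed.

End Lnorm2.

Section spinor_norm.
Context {R : realType}.
Local Notation mu := (@lebesgue_measure R).
Local Notation mu2 := (@lebesgue_measure R \x @lebesgue_measure R)%E.
Local Notation R2 := (measurableTypeR R * measurableTypeR R)%type.

Lemma cReD (a b : R[i]) : complex.Re (a + b) = complex.Re a + complex.Re b.
Proof. by case: a => a1 a2; case: b. Qed.

Lemma cImD (a b : R[i]) : complex.Im (a + b) = complex.Im a + complex.Im b.
Proof. by case: a => a1 a2; case: b. Qed.

Lemma cReZ (r : R) (a : R[i]) : complex.Re (r%:C * a) = r * complex.Re a.
Proof. by case: a => a1 a2 /=; rewrite mul0r subr0. Qed.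

Lemma cImZ (r : R) (a : R[i]) : complex.Im (r%:C * a) = r * complex.Im a.
Proof. by case: a => a1 a2 /=; rewrite mul0r addr0. Qed.

Lemma cReN (a : R[i]) : complex.Re (- a) = - complex.Re a.
Proof. by case: a. Qed.

Lemma cImN (a : R[i]) : complex.Im (- a) = - complex.Im a.
Proof. by case: a. Qed.

(** The triangle inequality in R^4, for the real and imaginary parts of two components.
    Cauchy-Schwarz comes from Lagrange's identity, which writes the gap as a sum of six squares. *)
Lemma sqrt_sum_triangle (a1 a2 a3 a4 b1 b2 b3 b4 : R) :
  Num.sqrt ((a1 + b1) ^+ 2 + (a2 + b2) ^+ 2 + ((a3 + b3) ^+ 2 + (a4 + b4) ^+ 2)) <=
  Num.sqrt (a1 ^+ 2 + a2 ^+ 2 + (a3 ^+ 2 + a4 ^+ 2)) +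
  Num.sqrt (b1 ^+ 2 + b2 ^+ 2 + (b3 ^+ 2 + b4 ^+ 2)).
Proof.
set a := a1 ^+ 2 + _ + _; set b := b1 ^+ 2 + _ + _.
have a0 : 0 <= a by rewrite !addr_ge0 ?sqr_ge0.
have b0 : 0 <= b by rewrite !addr_ge0 ?sqr_ge0.
have cs : a1 * b1 + a2 * b2 + a3 * b3 + a4 * b4 <= Num.sqrt a * Num.sqrt b.
  rewrite -sqrtrM//; apply: le_trans (ler_norm _) _.
  rewrite -sqrtr_sqr; apply: ler_wsqrtr; rewrite -subr_ge0.
  have -> : a * b - (a1 * b1 + a2 * b2 + a3 * b3 + a4 * b4) ^+ 2 =
    (a1 * b2 - a2 * b1) ^+ 2 + (a1 * b3 - a3 * b1) ^+ 2 + (a1 * b4 - a4 * b1) ^+ 2 +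
    (a2 * b3 - a3 * b2) ^+ 2 + (a2 * b4 - a4 * b2) ^+ 2 + (a3 * b4 - a4 * b3) ^+ 2.
    by rewrite /a /b; ring.
  by rewrite !addr_ge0 ?sqr_ge0.
rewrite -[leRHS]ger0_norm ?addr_ge0 ?sqrtr_ge0// -sqrtr_sqr; apply: ler_wsqrtr.
rewrite [leRHS]sqrrD !sqr_sqrtr//.
apply: (@le_trans _ _ (a + (a1 * b1 + a2 * b2 + a3 * b3 + a4 * b4) *+ 2 + b)).
  by rewrite /a /b le_eqVlt; apply/orP; left; apply/eqP; ring.
by rewrite lerD2r lerD2l lerMn2r cs orbT.
Qed.

Lemma ae2_imp (P Q : R2 -> Prop) : (forall x, P x -> Q x) ->
  {ae mu2, forall x, P x} -> {ae mu2, forall x, Q x}.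
Proof.
by move=> PQ; apply: filterS => //; exact: (ae_filter_ringOfSetsType mu2).
Qed.

Definition nsq (psi : spinor R) (x : R * R) : R := \sum_(k < 2)
    (complex.Re (psi x k 0) ^+ 2 + complex.Im (psi x k 0) ^+ 2).

Lemma nsq_ge0 psi x : 0 <= nsq psi x.
Proof. by apply: sumr_ge0 => k _; rewrite addr_ge0 ?sqr_ge0. Qed.

Lemma L2normE (psi : spinor R) :
  L2norm psi = ((\int[mu2]_x (nsq psi x)%:E) `^ 2^-1)%E.
Proof.
rewrite [LHS](@Lnorm2E _ _ _ mu2 (fun x => Num.sqrt (nsq psi x))).
by congr (_ `^ _)%E; apply: eq_integral => x _; rewrite sqr_sqrtr// nsq_ge0.
Qed.

Lemma L2spinor_measurable (psi : spinor R) (k : 'I_2) : L2spinor psi ->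
  measurable_fun [set: R2] (fun x => complex.Re (psi x k 0)) /\
  measurable_fun [set: R2] (fun x => complex.Im (psi x k 0)).
Proof. by move=> /(_ k)[/Lfun2P[mr _] /Lfun2P[mi _]]. Qed.

Lemma measurable_nsq (psi : spinor R) : L2spinor psi ->
  measurable_fun [set: R2] (nsq psi).
Proof.
move=> Lpsi; rewrite /nsq; under eq_fun do rewrite !big_ord_recl big_ord0 addr0.
have m0 := L2spinor_measurable ord0 Lpsi.
have m1 := L2spinor_measurable (lift ord0 ord0) Lpsi.
by apply: measurable_funD; apply: measurable_funD; apply: measurable_funX;
  [exact: m0.1|exact: m0.2|exact: m1.1|exact: m1.2].
Qed.

Lemma measurable_sqrt_nsq (psi : spinor R) : L2spinor psi ->
  measurable_fun [set: R2] (fun x => Num.sqrt (nsq psi x)).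
Proof.
move=> /measurable_nsq mn; apply: measurableT_comp => //.
by apply: continuous_measurable_fun; exact: sqrt_continuous.
Qed.

Lemma L2spinorD (psi phi : spinor R) : L2spinor psi -> L2spinor phi ->
  L2spinor (psi + phi).
Proof.
move=> Lpsi Lphi k; have [r1 i1] := Lpsi k; have [r2 i2] := Lphi k.
have reE : (fun x => complex.Re ((psi + phi) x k 0)) =
    (fun x => complex.Re (psi x k 0)) + (fun x => complex.Re (phi x k 0)).
  by apply/funext => x; rewrite [X in complex.Re X]mxE cReD.
have imE : (fun x => complex.Im ((psi + phi) x k 0)) =
    (fun x => complex.Im (psi x k 0)) + (fun x => complex.Im (phi x k 0)).
  by apply/funext => x; rewrite [X in complex.Im X]mxE cImD.
by rewrite /L2C reE imE; split; exact: Lfun2D.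
Qed.

Lemma L2spinorZ (r : R) (psi : spinor R) : L2spinor psi -> L2spinor (r%:C *: psi).
Proof.
move=> Lpsi k; have [r1 i1] := Lpsi k.
have reE : (fun x => complex.Re ((r%:C *: psi) x k 0)) =
    (fun x => r * complex.Re (psi x k 0)).
  by apply/funext => x; rewrite [X in complex.Re X]mxE cReZ.
have imE : (fun x => complex.Im ((r%:C *: psi) x k 0)) =
    (fun x => r * complex.Im (psi x k 0)).
  by apply/funext => x; rewrite [X in complex.Im X]mxE cImZ.
by rewrite /L2C reE imE; split; exact: Lfun2Z.
Qed.

Lemma nsqZ (r : R) (psi : spinor R) x : nsq (r%:C *: psi) x = r ^+ 2 * nsq psi x.
Proof.
rewrite /nsq mulr_sumr; apply: eq_bigr => k _.
by rewrite [(r%:C *: psi) x k 0]mxE cReZ cImZ; ring.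
Qed.

Lemma L2norm_ge0 (psi : spinor R) : (0 <= L2norm psi)%E.
Proof. exact: Lnorm_ge0. Qed.

Lemma L2norm_fin_num (psi : spinor R) : L2spinor psi -> L2norm psi \is a fin_num.
Proof.
move=> Lpsi; rewrite L2normE; apply: fin_num_poweR.
rewrite ge0_fin_numE; last by apply: integral_ge0 => x _; rewrite lee_fin nsq_ge0.
have [/Lfun2P[m1 r1] /Lfun2P[m2 r2]] := Lpsi ord0.
have [/Lfun2P[m3 r3] /Lfun2P[m4 r4]] := Lpsi (lift ord0 ord0).
rewrite /nsq; under eq_integral do rewrite !big_ord_recl big_ord0 addr0 !EFinD.
have msq (f : R2 -> R) : measurable_fun [set: R2] f ->
    measurable_fun [set: R2] (fun x => (f x ^+ 2)%:E).
  by move=> mf; apply/measurable_EFinP; exact: measurable_funX.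
rewrite ge0_integralD//.
- rewrite ge0_integralD//; try by [exact: msq|move=> x _; rewrite lee_fin sqr_ge0].
  rewrite ge0_integralD//; try by [exact: msq|move=> x _; rewrite lee_fin sqr_ge0].
  by apply: lte_add_pinfty; apply: lte_add_pinfty; [exact: r1|exact: r2|exact: r3|exact: r4].
- by move=> x _; rewrite adde_ge0// lee_fin sqr_ge0.
- by apply: emeasurable_funD; exact: msq.
- by move=> x _; rewrite adde_ge0// lee_fin sqr_ge0.
- by apply: emeasurable_funD; exact: msq.
Qed.

Lemma L2normZ (r : R) (psi : spinor R) : L2spinor psi ->
  L2norm (r%:C *: psi) = (`|r|%:E * L2norm psi)%E.
Proof.
move=> Lpsi; rewrite !L2normE.
under eq_integral do rewrite nsqZ EFinM.
rewrite ge0_integralZl//; last 3 first.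
- by apply/measurable_EFinP; exact: measurable_nsq.
- by move=> x _; rewrite lee_fin nsq_ge0.
- by rewrite lee_fin sqr_ge0.
rewrite poweRM ?lee_fin ?sqr_ge0//; last by apply: integral_ge0 => x _; rewrite lee_fin nsq_ge0.
by rewrite poweR_EFin powR12_sqrt ?sqr_ge0// sqrtr_sqr.
Qed.

(** The triangle inequality in C^2 holds pointwise; the scalar Minkowski inequality then applies to
    the pointwise norms. *)
Lemma L2norm_triangle (psi phi : spinor R) : L2spinor psi -> L2spinor phi ->
  (L2norm (psi + phi)%R <= L2norm psi + L2norm phi)%E.
Proof.
move=> Lpsi Lphi.
have m1 := measurable_sqrt_nsq Lpsi; have m2 := measurable_sqrt_nsq Lphi.
apply: le_trans (minkowski_EFin mu2 m1 m2 _); last by rewrite ler1n.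
apply: (@le_Lnorm2 _ _ _ mu2 (fun x => Num.sqrt (nsq (psi + phi) x))).
- by apply: measurable_sqrt_nsq; exact: L2spinorD.
- exact: measurable_funD.
- move=> x; rewrite sqrtr_ge0/= /nsq !big_ord_recl !big_ord0 !addr0.
  rewrite ![(psi + phi) x _ _]mxE !cReD !cImD; exact: sqrt_sum_triangle.
Qed.

Lemma L2norm_ae (psi phi : spinor R) : L2spinor psi -> L2spinor phi ->
  psi = phi %[ae mu2] -> L2norm psi = L2norm phi.
Proof.
move=> Lpsi Lphi E; rewrite !L2normE; congr (_ `^ _)%E.
apply: ge0_ae_eq_integral => //.
- by apply/measurable_EFinP; exact: measurable_nsq.
- by apply/measurable_EFinP; exact: measurable_nsq.
- by move=> x _; rewrite lee_fin nsq_ge0.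
- by move=> x _; rewrite lee_fin nsq_ge0.
- by apply: ae2_imp E => x /= + _ => /(_ I) e; rewrite /nsq e.
Qed.

Lemma L2norm0_ae (psi : spinor R) : L2spinor psi -> L2norm psi = 0%E ->
  psi = 0 %[ae mu2].
Proof.
move=> Lpsi N0.
have m1 : measurable_fun [set: R2] (fun x => (Num.sqrt (nsq psi x))%:E).
  by apply/measurable_EFinP; exact: measurable_sqrt_nsq.
have := Lnorm_eq0_eq0 m1 _ N0; rewrite lte_fin ltr0n => /(_ isT).
apply: ae2_imp => x /= + _ => /(_ I) [] /eqP; rewrite sqrtr_eq0 => n0.
have : nsq psi x == 0 by rewrite eq_le n0 nsq_ge0.
rewrite psumr_eq0; last by move=> k _; rewrite addr_ge0 ?sqr_ge0.
move=> /allP z; apply/colP => k; rewrite mxE.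
have := z k (mem_index_enum _); rewrite paddr_eq0 ?sqr_ge0// !sqrf_eq0.
move=> /andP[/eqP re /eqP im]; case: (psi x k 0) re im => a b /= -> ->; exact: erefl.
Qed.

End spinor_norm.

(** * Traveling waves and the Dirac operator *)

Section wave.
Context {R : realType}.
Local Notation mu := (@lebesgue_measure R).
Local Notation mu2 := (@lebesgue_measure R \x @lebesgue_measure R)%E.
Local Notation R2 := (measurableTypeR R * measurableTypeR R)%type.
Implicit Types (a : R -> R) (G : R -> R[i]).

Definition L2cont a := continuous a /\ a \in Lfun mu 2%:E.

Definition L2contC G := L2cont (fun u => complex.Re (G u)) /\ L2cont (fun u => complex.Im (G u)).

Definition is_deriveC G dG := forall x : R,
  is_derive x 1 (fun u => complex.Re (G u)) (complex.Re (dG x)) /\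
  is_derive x 1 (fun u => complex.Im (G u)) (complex.Im (dG x)).

Lemma cReM (a b : R[i]) : complex.Re (a * b) =
  complex.Re a * complex.Re b - complex.Im a * complex.Im b.
Proof. by case: a => a1 a2; case: b. Qed.

Lemma cImM (a b : R[i]) : complex.Im (a * b) =
  complex.Re a * complex.Im b + complex.Im a * complex.Re b.
Proof. by case: a => a1 a2; case: b. Qed.

Lemma L2cont_lin (r s : R) a b : L2cont a -> L2cont b ->
  L2cont (fun u => r * a u + s * b u).
Proof.
move=> [ca La] [cb Lb]; split.
  by move=> u; apply: cvgD; apply: cvgM; try exact: cvg_cst; [exact: ca|exact: cb].
by apply: Lfun2D; exact: Lfun2Z.
Qed.

Lemma L2cont_shift (t : R) a : L2cont a -> L2cont (fun u => a (u - t)).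
Proof.
move=> [ca La]; split.
  move=> u; apply: (@continuous_comp _ _ _ (fun u => u - t) a); last exact: ca.
  by apply: cvgB; [exact: cvg_id|exact: cvg_cst].
have /Lfun2P[ma ay] := La; apply/Lfun2P; split.
  by apply: measurableT_comp => //; exact: measurable_funB.
rewrite (@ge0_integral_shift R (- t) (fun u => (a u ^+ 2)%:E))//.
- by apply/measurable_EFinP; exact: measurable_funX.
- by move=> u; rewrite lee_fin sqr_ge0.
Qed.

Lemma L2cont_avg (h : R) a : L2cont a -> L2cont (avg h a).
Proof.
move=> [ca La]; split; first exact: continuous_avg.
have /Lfun2P[ma ay] := La; apply/Lfun2P; split.
  by apply: continuous_measurable_fun; exact: continuous_avg.
exact: (le_lt_trans (avg_L2 h ca) ay).
Qed.

Section wall.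
Variables (theta : R) (m : R -> R) (C : R).
Hypotheses (hm : domain_wall_profile m) (C0 : 0 < C).
Hypothesis chi1 : (\int[mu]_u (chi C m u ^+ 2)%:E = 1)%E.
Local Notation mode := (mode theta m C).
Local Notation dmode := (dmode theta m C).

Definition amp : 'cV[R[i]]_2 := vec2 (cos (theta / 2))%:C ('i%C * (sin (theta / 2))%:C).

Definition wave G : spinor R := fun x =>
  ((chi C m (ndot theta x))%:C * G (tdot theta x)) *: amp.

Definition dwave (v : R * R) G dG : spinor R := fun x =>
  (ndot theta v * - m (ndot theta x))%:C *: wave G x + (tdot theta v)%:C *: wave dG x.

(** The amplitude is absorbed into the complex profile, so each component of a wave reduces to two
    real modes. *)
Lemma Re_wave G x k : complex.Re (wave G x k 0) = mode (fun u => complex.Re (G u * amp k 0)) x.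
Proof. by rewrite mxE -mulrA cReZ. Qed.

Lemma Im_wave G x k : complex.Im (wave G x k 0) = mode (fun u => complex.Im (G u * amp k 0)) x.
Proof. by rewrite mxE -mulrA cImZ. Qed.

Lemma Re_dwave v G dG x k : complex.Re (dwave v G dG x k 0) =
  dmode v (fun u => complex.Re (G u * amp k 0)) (fun u => complex.Re (dG u * amp k 0)) x.
Proof.
rewrite /dwave [X in complex.Re X]mxE cReD [X in complex.Re X + _]mxE.
by rewrite [X in _ + complex.Re X]mxE !cReZ !Re_wave.
Qed.

Lemma Im_dwave v G dG x k : complex.Im (dwave v G dG x k 0) =
  dmode v (fun u => complex.Im (G u * amp k 0)) (fun u => complex.Im (dG u * amp k 0)) x.
Proof.
rewrite /dwave [X in complex.Im X]mxE cImD [X in complex.Im X + _]mxE.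
by rewrite [X in _ + complex.Im X]mxE !cImZ !Im_wave.
Qed.

Lemma mode_sqr_integral a : measurable_fun setT a ->
  (\int[mu2]_x (mode a x ^+ 2)%:E = \int[mu]_u (a u ^+ 2)%:E)%E.
Proof.
move=> ma.
have mc : measurable_fun setT (chi C m).
  by apply: continuous_measurable_fun; exact: continuous_chi.
under eq_integral do rewrite exprMn EFinM.
rewrite (@ge0_integral_rotation R theta (fun u => (chi C m u ^+ 2)%:E) (fun u => (a u ^+ 2)%:E)).
- by rewrite chi1 mul1e.
- by apply/measurable_EFinP; exact: measurable_funX.
- by apply/measurable_EFinP; exact: measurable_funX.
- by move=> u; rewrite lee_fin sqr_ge0.
- by move=> u; rewrite lee_fin sqr_ge0.
Qed.

Lemma mode_Lfun a : L2cont a -> mode a \in Lfun mu2 2%:E.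
Proof.
move=> [ca /Lfun2P[ma ay]]; apply/Lfun2P; split.
  by apply: continuous_measurable2; exact: continuous_mode.
by rewrite mode_sqr_integral.
Qed.

Lemma dmode_Lfun v a da : L2cont a -> L2cont da -> dmode v a da \in Lfun mu2 2%:E.
Proof.
move=> La Lda; apply: Lfun2D; last by apply: Lfun2Z; exact: mode_Lfun.
have [B B0 mB] := wall_bounded hm.
apply: (@Lfun2M_bounded _ _ _ mu2 (fun x => ndot theta v * - m (ndot theta x)) _ (`|ndot theta v| * B)).
- apply: measurable_funM => //; apply: measurable_funN.
  exact: (measurableT_comp (measurable_wall hm) (@measurable_ndot R theta)).
- by move=> x; rewrite normrM normrN ler_wpM2l.
- exact: mode_Lfun.
Qed.

Lemma L2contC_Re G (z : R[i]) : L2contC G -> L2cont (fun u => complex.Re (G u * z)).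
Proof.
move=> [Lr Li]; have := L2cont_lin (complex.Re z) (- complex.Im z) Lr Li.
by congr L2cont; apply/funext => u; rewrite cReM; ring.
Qed.

Lemma L2contC_Im G (z : R[i]) : L2contC G -> L2cont (fun u => complex.Im (G u * z)).
Proof.
move=> [Lr Li]; have := L2cont_lin (complex.Im z) (complex.Re z) Lr Li.
by congr L2cont; apply/funext => u; rewrite cImM; ring.
Qed.

Lemma is_derive_lin (r s : R) (a b : R -> R) (da db x : R) :
  is_derive x 1 a da -> is_derive x 1 b db ->
  is_derive x 1 (fun u => r * a u + s * b u) (r * da + s * db).
Proof.
move=> dera derb; exact: (is_deriveD (is_deriveZ r dera) (is_deriveZ s derb)).
Qed.

Lemma is_deriveC_Re G dG (z : R[i]) (x : R) : is_deriveC G dG ->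
  is_derive x 1 (fun u => complex.Re (G u * z)) (complex.Re (dG x * z)).
Proof.
move=> /(_ x)[dr di]; have := is_derive_lin (complex.Re z) (- complex.Im z) dr di.
by rewrite cReM; congr is_derive; [apply/funext => u; rewrite cReM|]; ring.
Qed.

Lemma is_deriveC_Im G dG (z : R[i]) (x : R) : is_deriveC G dG ->
  is_derive x 1 (fun u => complex.Im (G u * z)) (complex.Im (dG x * z)).
Proof.
move=> /(_ x)[dr di]; have := is_derive_lin (complex.Im z) (complex.Re z) dr di.
by rewrite cImM; congr is_derive; [apply/funext => u; rewrite cImM|]; ring.
Qed.

Lemma L2spinor_wave G : L2contC G -> L2spinor (wave G).
Proof.
move=> LG k; split.
  by under eq_fun do rewrite Re_wave; apply: mode_Lfun; exact: L2contC_Re.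
by under eq_fun do rewrite Im_wave; apply: mode_Lfun; exact: L2contC_Im.
Qed.

Lemma L2spinor_dwave v G dG : L2contC G -> L2contC dG -> L2spinor (dwave v G dG).
Proof.
move=> LG LdG k; split.
  by under eq_fun do rewrite Re_dwave; apply: dmode_Lfun; exact: L2contC_Re.
by under eq_fun do rewrite Im_dwave; apply: dmode_Lfun; exact: L2contC_Im.
Qed.

(** [Cn] records derivatives along [e1] and [e2] only; the hypothesis on test functions lets one
    argument serve both directions. *)
Lemma wave_weak_partial (v : R * R) G dG (k : 'I_2) : `|v| <= 1 ->
  (forall phi : R * R -> R, test_function phi ->
     [/\ forall x, derivable phi x v & continuous ('D_v phi)]) ->
  L2contC dG -> is_deriveC G dG ->
  weak_partial v (fun x => wave G x k 0) (fun x => dwave v G dG x k 0).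
Proof.
move=> v1 testv LdG GdG phi tphi.
have [dphi cdphi] := testv _ tphi.
have [Cphi sphi] := tphi; have cphi : continuous phi := (Cphi 0%N).1.
(* A real test function commutes with real and imaginary parts, so the identity splits into two real
   ones. *)
apply: (f_equal2 (@Complex R)).
- under eq_Rintegral do rewrite mulrC cReZ mulrC Re_wave.
  under [X in _ = - X]eq_Rintegral do rewrite mulrC cReZ mulrC Re_dwave.
  apply: mode_weak_derivative => //; first by have [] := L2contC_Re (amp k 0) LdG.
  by move=> x; exact: is_deriveC_Re.
- under eq_Rintegral do rewrite mulrC cImZ mulrC Im_wave.
  under [X in _ = - X]eq_Rintegral do rewrite mulrC cImZ mulrC Im_dwave.
  apply: mode_weak_derivative => //; first by have [] := L2contC_Im (amp k 0) LdG.
  by move=> x; exact: is_deriveC_Im.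
Qed.

Lemma norm_e1 : `|e1 R| <= 1.
Proof. by rewrite prod_normE/= normr1 normr0 maxEle ler10. Qed.

Lemma norm_e2 : `|e2 R| <= 1.
Proof. by rewrite prod_normE/= normr1 normr0 maxEle ler01. Qed.

Lemma H1_wave G dG : L2contC G -> L2contC dG -> is_deriveC G dG ->
  H1_with (wave G) (dwave (e1 R) G dG) (dwave (e2 R) G dG).
Proof.
move=> LG LdG GdG; split.
- exact: L2spinor_wave.
- exact: L2spinor_dwave.
- exact: L2spinor_dwave.
move=> k; split; apply: wave_weak_partial => //; try by [exact: norm_e1|exact: norm_e2].
- by move=> phi [/(_ 1%N)/= [_ [d1 _ [c1 _] _]] _].
- by move=> phi [/(_ 1%N)/= [_ [_ d2 _ [c2 _]]] _].
Qed.

Lemma waveE G x k : wave G x k 0 = (chi C m (ndot theta x))%:C * G (tdot theta x) * amp k 0.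
Proof. by rewrite mxE. Qed.

Lemma dwaveE v G dG x k : dwave v G dG x k 0 =
  (ndot theta v * - m (ndot theta x))%:C * wave G x k 0 + (tdot theta v)%:C * wave dG x k 0.
Proof. by rewrite /dwave mxE [X in X + _]mxE [X in _ + X]mxE. Qed.

(** With c and s the cosine and sine of [theta / 2], the terms in [m G] carry the factors
    [(1 + cos theta) s - sin theta c] and [(1 - cos theta) c - sin theta s], both 0 by the
    half-angle formulas. In the terms in [dG], the vector (c, i s) is an eigenvector with eigenvalue
    i. *)
Lemma dirac_wave G dG : L2contC G -> L2contC dG -> is_deriveC G dG ->
  dirac_graph theta m (wave G) ('i%C *: wave dG).
Proof.
move=> LG LdG GdG; exists (dwave (e1 R) G dG), (dwave (e2 R) G dG).
split; first exact: H1_wave.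
apply: aeW => x _; apply/colP => k.
set c := cos (theta / 2); set s := sin (theta / 2).
have cs1 : c ^+ 2 + s ^+ 2 = 1 by exact: cos2Dsin2.
have cosE : cos theta = c ^+ 2 - s ^+ 2.
  by rewrite [in LHS](splitr theta) cosD !expr2.
have sinE : sin theta = 2 * c * s.
  by rewrite [in LHS](splitr theta) sinD -/c -/s; ring.
have cs2 : c ^+ 2 = 1 - s ^+ 2 by rewrite -cs1 addrK.
have A0 : amp 0 0 = c%:C by rewrite mxE.
have A1 : amp 1 0 = 'i%C * s%:C by rewrite mxE.
have n1 : ndot theta (e1 R) = cos theta by rewrite /ndot/= mulr1 mulr0 addr0.
have n2 : ndot theta (e2 R) = sin theta by rewrite /ndot/= mulr1 mulr0 add0r.
have t1 : tdot theta (e1 R) = - sin theta by rewrite /tdot/= mulr1 mulr0 addr0.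
have t2 : tdot theta (e2 R) = cos theta by rewrite /tdot/= mulr1 mulr0 add0r.
rewrite [LHS]mxE [RHS]mxE !dwaveE !waveE A0 A1 n1 n2 t1 t2 cosE sinE.
have -> : amp k 0 = if k == 0 then c%:C else 'i%C * s%:C by rewrite mxE.
(* Once the function values are generalized, each real or imaginary part is a polynomial identity
   modulo [c^2 = 1 - s^2]. *)
move: (chi C m _) (m _) (G _) (dG _) => X M [g1 g2] [h1 h2].
case: ifP => _; apply/eqP; rewrite eq_complex /=; apply/andP; split; apply/eqP.
- ring: cs2.
- ring: cs2.
- ring: cs2.
- ring: cs2.
Qed.



End wall.
End wave.

(** * The L^2 norm of spinors as a real number *)

Section norm.
Context {R : realType}.
Local Notation mu := (@lebesgue_measure R).
Local Notation mu2 := (@lebesgue_measure R \x @lebesgue_measure R)%E.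
Local Notation R2 := (measurableTypeR R * measurableTypeR R)%type.
Implicit Types (psi phi : spinor R).

(** [fine] sends an infinite norm to 0, so the value is meaningful only together with membership in
    L^2, which the lemmas carry along. *)
Definition nrm psi : R := fine (L2norm psi).

Lemma L2spinorB psi phi : L2spinor psi -> L2spinor phi -> L2spinor (psi - phi).
Proof.
move=> Lpsi Lphi; apply: L2spinorD => //.
by have := L2spinorZ (-1) Lphi; rewrite rmorphN1 scaleN1r.
Qed.

Lemma nrm_ge0 psi : 0 <= nrm psi.
Proof. by rewrite fine_ge0// L2norm_ge0. Qed.

Lemma nrm_triangle psi phi : L2spinor psi -> L2spinor phi ->
  nrm (psi + phi) <= nrm psi + nrm phi.
Proof.
move=> Lpsi Lphi.
have f1 := L2norm_fin_num Lpsi; have f2 := L2norm_fin_num Lphi.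
have f12 := L2norm_fin_num (L2spinorD Lpsi Lphi).
by rewrite /nrm -fineD// fine_le ?fin_numD ?f1//; exact: L2norm_triangle.
Qed.

Lemma nrmZ (r : R) psi : L2spinor psi -> nrm (r%:C *: psi) = `|r| * nrm psi.
Proof.
by move=> Lpsi; rewrite /nrm L2normZ// fineM//; exact: L2norm_fin_num.
Qed.

Lemma nrmN psi : L2spinor psi -> nrm (- psi) = nrm psi.
Proof.
by move=> Lpsi; rewrite -scaleN1r -(rmorphN1 (real_complex R)) nrmZ// normrN1 mul1r.
Qed.

Lemma nrmBC psi phi : L2spinor psi -> L2spinor phi -> nrm (psi - phi) = nrm (phi - psi).
Proof. by move=> Lpsi Lphi; rewrite -nrmN ?opprB//; exact: L2spinorB. Qed.

Lemma nrm_ae psi phi : L2spinor psi -> L2spinor phi ->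
  psi = phi %[ae mu2] -> nrm psi = nrm phi.
Proof. by move=> Lpsi Lphi E; rewrite /nrm (L2norm_ae Lpsi Lphi E). Qed.

Lemma nrm_eq0 psi phi : L2spinor psi -> L2spinor phi -> nrm (psi - phi) = 0 ->
  psi = phi %[ae mu2].
Proof.
move=> Lpsi Lphi N0; have LB := L2spinorB Lpsi Lphi.
have : L2norm (psi - phi) = 0%E.
  by rewrite -[LHS]fineK ?L2norm_fin_num// -/(nrm (psi - phi)) N0.
move=> /(L2norm0_ae LB); apply: ae2_imp => x /= + _ => /(_ I) /eqP.
by rewrite [(psi - phi) x]/(psi x - phi x) subr_eq0 => /eqP.
Qed.

End norm.

(** * Norms of waves, their averages and their translates *)

Section wave_norm.
Context {R : realType}.
Local Notation mu := (@lebesgue_measure R).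
Local Notation mu2 := (@lebesgue_measure R \x @lebesgue_measure R)%E.
Local Notation R2 := (measurableTypeR R * measurableTypeR R)%type.
Implicit Types (a : R -> R) (G : R -> R[i]).

Definition avgC (h : R) G (u : R) : R[i] :=
  avg h (fun v => complex.Re (G v)) u +i* avg h (fun v => complex.Im (G v)) u.

Lemma is_deriveC_avgC (h : R) G : L2contC G -> h != 0 ->
  is_deriveC (avgC h G) (fun u => (h^-1)%:C * (G u - G (u - h))).
Proof.
move=> [[cr _] [ci _]] h0 x; rewrite cReZ cImZ cReD cImD cReN cImN.
by split; [exact: (is_derive_avg x cr h0)|exact: (is_derive_avg x ci h0)].
Qed.

Lemma L2contC_avgC (h : R) G : L2contC G -> L2contC (avgC h G).
Proof. by move=> [Lr Li]; split; exact: L2cont_avg. Qed.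

Lemma L2contC_shift (t : R) G : L2contC G -> L2contC (fun u => G (u - t)).
Proof.
by move=> [Lr Li]; split; [exact: (L2cont_shift t Lr)|exact: (L2cont_shift t Li)].
Qed.

Lemma L2contCB G H : L2contC G -> L2contC H -> L2contC (fun u => G u - H u).
Proof.
move=> [Gr Gi] [Hr Hi]; split.
  have := L2cont_lin 1 (-1) Gr Hr; congr L2cont; apply/funext => u.
  by rewrite cReD cReN mul1r mulN1r.
have := L2cont_lin 1 (-1) Gi Hi; congr L2cont; apply/funext => u.
by rewrite cImD cImN mul1r mulN1r.
Qed.

Lemma L2contCZ (r : R) G : L2contC G -> L2contC (fun u => r%:C * G u).
Proof.
move=> [Gr Gi]; split.
  have := L2cont_lin r 0 Gr Gr; congr L2cont; apply/funext => u.
  by rewrite cReZ mul0r addr0.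
have := L2cont_lin r 0 Gi Gi; congr L2cont; apply/funext => u.
by rewrite cImZ mul0r addr0.
Qed.

Lemma is_deriveC_shift (t : R) G dG : is_deriveC G dG ->
  is_deriveC (fun u => G (u - t)) (fun u => dG (u - t)).
Proof.
have sh (b : R -> R) (db : R) (x : R) : is_derive (x - t) 1 b db ->
    is_derive x 1 (fun u => b (u - t)) db.
  move=> derb; rewrite -[db]mulr1.
  have -> : (fun u => b (u - t)) = b \o (fun u => - t + 1 * u).
    by apply/funext => u /=; rewrite mul1r addrC.
  apply: is_derive1_comp; last exact: is_derive_affine.
  by rewrite mul1r addrC.
by move=> GdG x; have [dr di] := GdG (x - t); split; [exact: (sh _ _ _ dr)|exact: (sh _ _ _ di)].
Qed.

Lemma translate_quotient G dG (k u : R) : L2contC dG -> is_deriveC G dG -> k != 0 ->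
  (k^-1)%:C * (G (u - k) - G u) = - avgC k dG u.
Proof.
move=> [[cr _] [ci _]] GdG k0.
have := avg_primitive k u cr (fun x => (GdG x).1).
have := avg_primitive k u ci (fun x => (GdG x).2).
rewrite /avgC; move: (avg _ _ _) (avg _ _ _) => A B EA EB.
apply/eqP; rewrite eq_complex cReZ cImZ cReD cImD cReN cImN /=; apply/andP; split; apply/eqP.
  by rewrite -opprB -EB mulrN mulKf.
by rewrite -opprB -EA mulrN mulKf.
Qed.

Section wall.
Variables (theta : R) (m : R -> R) (C : R).
Hypotheses (hm : domain_wall_profile m) (C0 : 0 < C).
Hypothesis chi1 : (\int[mu]_u (chi C m u ^+ 2)%:E = 1)%E.
Local Notation mode := (mode theta m C).
Local Notation wave := (wave theta m C).

(** The amplitude is a unit vector, so it disappears from the pointwise norm. *)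
Lemma nsq_wave G x : nsq (wave G) x =
  mode (fun u => complex.Re (G u)) x ^+ 2 + mode (fun u => complex.Im (G u)) x ^+ 2.
Proof.
rewrite /nsq !big_ord_recl big_ord0 addr0 !waveE.
have -> : amp theta ord0 0 = (cos (theta / 2))%:C by rewrite mxE.
have -> : amp theta (lift ord0 ord0) 0 = 'i%C * (sin (theta / 2))%:C by rewrite mxE.
have cs1 := cos2Dsin2 (theta / 2).
move: (cos (theta / 2)) (sin (theta / 2)) cs1 => c s cs1.
have cs2 : c ^+ 2 = 1 - s ^+ 2 by rewrite -cs1 addrK.
rewrite /mode; move: (chi C m _) (G _) => X [g1 g2] /=.
ring: cs2.
Qed.

Lemma nrm_wave G : L2contC G -> nrm (wave G) =
  Num.sqrt (fine (\int[mu]_u (complex.Re (G u) ^+ 2)%:E) +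
            fine (\int[mu]_u (complex.Im (G u) ^+ 2)%:E)).
Proof.
move=> [[cr Lr] [ci Li]].
have [/Lfun2P[mr ry] /Lfun2P[mi iy]] := conj Lr Li.
rewrite /nrm L2normE; under eq_integral do rewrite nsq_wave EFinD.
have mm a : continuous a -> measurable_fun [set: R2] (fun x => (mode a x ^+ 2)%:E).
  move=> ca; apply/measurable_EFinP; apply: measurable_funX.
  by apply: continuous_measurable2; exact: continuous_mode.
rewrite ge0_integralD//; last 4 first.
- by move=> x _; rewrite lee_fin sqr_ge0.
- exact: mm.
- by move=> x _; rewrite lee_fin sqr_ge0.
- exact: mm.
rewrite !mode_sqr_integral// fine_poweR fineD ?ge0_fin_numE//.
- by rewrite powR12_sqrt// addr_ge0// fine_ge0// integral_ge0// => x _; rewrite lee_fin sqr_ge0.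
- by apply: integral_ge0 => x _; rewrite lee_fin sqr_ge0.
- by apply: integral_ge0 => x _; rewrite lee_fin sqr_ge0.
Qed.

Lemma wave_avg_cvg G : L2contC G ->
  nrm (wave (fun u => avgC k G u - G u)) @[k --> 0^'] --> 0.
Proof.
move=> LG; have [[cr Lr] [ci Li]] := LG.
have [/Lfun2P[mr ry] /Lfun2P[mi iy]] := conj Lr Li.
have E k : nrm (wave (fun u => avgC k G u - G u)) =
  Num.sqrt (fine (\int[mu]_u ((avg k (fun v => complex.Re (G v)) u - complex.Re (G u)) ^+ 2)%:E) +
            fine (\int[mu]_u ((avg k (fun v => complex.Im (G v)) u - complex.Im (G u)) ^+ 2)%:E)).
  rewrite nrm_wave; last by apply: L2contCB => //; exact: L2contC_avgC.
  by under eq_integral do rewrite cReD cReN; under [in X in _ + X]eq_integral do rewrite cImD cImN.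
rewrite (funext E) -[X in _ --> X]sqrtr0 -[X in Num.sqrt X]addr0.
apply: (@cvg_comp _ _ _ _ (@Num.sqrt R)); last exact: sqrt_continuous.
by apply: cvgD; exact: avg_L2_cvg.
Qed.

Lemma waveB G H : wave G - wave H = wave (fun u => G u - H u).
Proof.
apply/funext => x; rewrite -[LHS]/(wave G x - wave H x) /wave -scalerBl.
by rewrite -mulrBr.
Qed.

Lemma waveZ (r : R) G : r%:C *: wave G = wave (fun u => r%:C * G u).
Proof.
apply/funext => x; rewrite -[LHS]/(r%:C *: wave G x) /wave scalerA.
by rewrite mulrCA.
Qed.

Lemma nrm_wave_shift (t : R) G : L2contC G -> nrm (wave (fun u => G (u - t))) = nrm (wave G).
Proof.
move=> LG; have [[cr Lr] [ci Li]] := LG.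
have [/Lfun2P[mr ry] /Lfun2P[mi iy]] := conj Lr Li.
rewrite !nrm_wave//; last exact: L2contC_shift.
have sh a : measurable_fun setT a ->
    (\int[mu]_u (a (u - t) ^+ 2)%:E = \int[mu]_u (a u ^+ 2)%:E)%E.
  move=> ma; rewrite (@ge0_integral_shift R (- t) (fun u => (a u ^+ 2)%:E))//.
    by apply/measurable_EFinP; exact: measurable_funX.
  by move=> u; rewrite lee_fin sqr_ge0.
by rewrite (sh _ mr) (sh _ mi).
Qed.

(** By [translate_quotient] the spinor inside the norm is the opposite of [wave (avgC k dG - dG)],
    which tends to 0 in L^2. *)
Lemma translate_generator G dG : L2contC G -> L2contC dG -> is_deriveC G dG ->
  nrm ((k^-1)%:C *: (wave (fun u => G (u - k)) - wave G) - (- wave dG))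
    @[k --> 0^'] --> 0.
Proof.
move=> LG LdG GdG; have := wave_avg_cvg LdG.
apply: cvg_trans; apply: near_eq_cvg; near=> k.
have k0 : k != 0 by near: k; exact: nbhs_dnbhs_neq.
rewrite -[LHS]nrmN; last by apply: L2spinor_wave => //; apply: L2contCB => //; exact: L2contC_avgC.
congr nrm; rewrite waveB waveZ -waveB opprB opprK addrC; congr (_ + _).
apply/funext => x; rewrite -[LHS]/(- wave (avgC k dG) x) /wave -scaleNr -mulrN.
by rewrite (translate_quotient _ LdG GdG k0).
Unshelve. all: by end_near. Qed.

End wall.
End wave_norm.

(** * Evolution *)

Section group.
Context {R : realType}.
Local Notation mu := (@lebesgue_measure R).
Local Notation mu2 := (@lebesgue_measure R \x @lebesgue_measure R)%E.
Local Notation R2 := (measurableTypeR R * measurableTypeR R)%type.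
Variable U : R -> spinor R -> spinor R.
Hypothesis hU : unitary_group U.

Lemma nrm_unitary t psi : L2spinor psi -> nrm (U t psi) = nrm psi.
Proof. by move=> Lpsi; rewrite /nrm (ug_isometry hU). Qed.

Lemma nrm_unitaryB t psi phi : L2spinor psi -> L2spinor phi ->
  nrm (U t psi - U t phi) = nrm (psi - phi).
Proof.
move=> Lpsi Lphi; rewrite -(nrm_unitary t (L2spinorB Lpsi Lphi)).
have LN : L2spinor ((-1 : R[i]) *: phi).
  by have := L2spinorZ (-1) Lphi; rewrite rmorphN1.
have LUpsi := ug_L2 hU t Lpsi; have LUphi := ug_L2 hU t Lphi.
have LB := L2spinorB Lpsi Lphi.
apply: nrm_ae; [exact: L2spinorB|exact: (ug_L2 hU)|].
have := ug_linear hU t (-1) Lphi Lpsi.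
by apply: ae2_imp => x /= + _ => /(_ I); rewrite !scaleN1r ![- _ + _]addrC => ->.
Qed.

(* Telescoping through U k phi; the first piece has the norm of U s psi - phi. *)
Lemma nrm_group_step (s k : R) psi phi phi' : L2spinor psi -> L2spinor phi ->
  L2spinor phi' ->
  `|nrm (U (k + s) psi - phi') - nrm (U s psi - phi)| <= nrm (U k phi - phi').
Proof.
move=> Lpsi Lphi Lphi'.
have LUs := ug_L2 hU s Lpsi; have LUks := ug_L2 hU (k + s) Lpsi.
have LUk := ug_L2 hU k Lphi; have LUkUs := ug_L2 hU k LUs.
have E : nrm (U (k + s) psi - phi') = nrm (U k (U s psi) - phi').
  apply: nrm_ae; try exact: L2spinorB.
  have := ug_add hU k s Lpsi; apply: ae2_imp => x /= + _ => /(_ I) e.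
  by rewrite -[LHS]/(U (k + s) psi x - phi' x) e.
rewrite E -(nrm_unitaryB k LUs Lphi).
have LA := L2spinorB LUkUs Lphi'; have LB := L2spinorB LUkUs LUk.
have LC := L2spinorB LUk Lphi'.
rewrite ler_distlC; apply/andP; split.
  by rewrite lerBlDr; have := nrm_triangle LB LC; rewrite addrA subrK.
have := nrm_triangle LA (L2spinorB Lphi' LUk).
by rewrite addrA subrK (nrmBC Lphi' LUk).
Qed.

End group.

Section evolution.
Context {R : realType}.

Lemma cvgD0 (F : set_system R) {FF : Filter F} (a b : R -> R) :
  a k @[k --> F] --> 0 -> b k @[k --> F] --> 0 -> a k + b k @[k --> F] --> 0.
Proof. by move=> a0 b0; rewrite -[X in _ --> X](addr0 (0 : R)); exact: cvgD. Qed.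


Local Notation mu := (@lebesgue_measure R).
Local Notation mu2 := (@lebesgue_measure R \x @lebesgue_measure R)%E.
Local Notation R2 := (measurableTypeR R * measurableTypeR R)%type.
Variables (theta : R) (m : R -> R) (C : R).
Hypotheses (hm : domain_wall_profile m) (C0 : 0 < C).
Hypothesis chi1 : (\int[mu]_u (chi C m u ^+ 2)%:E = 1)%E.
Variable U : R -> spinor R -> spinor R.
Hypothesis hU : is_exp_group (dirac_graph theta m) U.
Local Notation wave := (wave theta m C).

(** The generator is i times the Dirac operator, which sends [wave G] to ['i *: wave dG]; the sign
    is [i^2 = -1]. *)
Lemma generator_wave G dG : L2contC G -> L2contC dG -> is_deriveC G dG ->
  generator U (wave G) (- wave dG).
Proof.
move=> LG LdG GdG; have LwG := L2spinor_wave theta hm C0 chi1 LG.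
have LwdG := L2spinor_wave theta hm C0 chi1 LdG.
apply/(hU.2 _ _ LwG).
  by have := L2spinorZ (-1) LwdG; rewrite rmorphN1 scaleN1r.
exists ('i%C *: wave dG); split; first exact: dirac_wave.
apply: aeW => x _; rewrite -[LHS]/(- wave dG x) -[RHS]/('i%C *: ('i%C *: wave dG x)).
by rewrite scalerA -expr2 sqr_i scaleN1r.
Qed.

(** Being real valued, it reduces uniqueness of the evolution to the fact that a real function with
    zero derivative is constant. *)
Let defect G (s : R) := nrm (U s (wave G) - wave (fun u => G (u - s))).

Lemma is_derive_defect G dG (s : R) : L2contC G -> L2contC dG -> is_deriveC G dG ->
  is_derive s 1 (defect G) 0.
Proof.
move=> LG LdG GdG; have Lw H := @L2spinor_wave R theta m C hm C0 chi1 H.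
pose Gs u := G (u - s); pose dGs u := dG (u - s).
have LGs : L2contC Gs by exact: L2contC_shift.
have LdGs : L2contC dGs by exact: L2contC_shift.
have GsdGs : is_deriveC Gs dGs by exact: is_deriveC_shift.
have LN : L2spinor (- wave dGs).
  by have := L2spinorZ (-1) (Lw _ LdGs); rewrite rmorphN1 scaleN1r.
(* [q1] and [q2] measure how far the quotients of [U k] and of the translation by [k], started from
   the traveling wave at time s, are from their common limit [- wave dGs]. The first tends to 0 by
   the generator of [U], the second by the Steklov averages. *)
pose q1 k := nrm ((k^-1)%:C *: (U k (wave Gs) - wave Gs) - (- wave dGs)).
pose q2 k := nrm ((k^-1)%:C *: (wave (fun u => Gs (u - k)) - wave Gs) - (- wave dGs)).
have q1_0 : q1 k @[k --> 0^'] --> 0.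
  have := generator_wave LGs LdGs GsdGs; rewrite /generator.
  by move/fine_cvgP => [].
have q2_0 : q2 k @[k --> 0^'] --> 0 := translate_generator theta hm C0 chi1 LGs LdGs GsdGs.
have q12_0 : q1 k + q2 k @[k --> 0^'] --> 0 by exact: cvgD0 q1_0 q2_0.
have step k : k != 0 -> `|k^-1 * (defect G (k + s) - defect G s)| <= q1 k + q2 k.
  move=> k0; rewrite normrM normfV ler_pdivrMl ?normr_gt0//.
  have LGsk : L2contC (fun u => Gs (u - k)) by exact: L2contC_shift.
  have := nrm_group_step hU.1 s k (Lw _ LG) (Lw _ LGs) (Lw _ LGsk).
  have Ew : wave (fun u => Gs (u - k)) = wave (fun u => G (u - (k + s))).
    by congr wave; apply/funext => u; rewrite /Gs opprD addrA.
  rewrite {1}Ew => /le_trans; apply.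
  have LUk := ug_L2 hU.1 k (Lw _ LGs).
  have LA := L2spinorB LUk (Lw _ LGs); have LB := L2spinorB (Lw _ LGsk) (Lw _ LGs).
  have LA1 := L2spinorB (L2spinorZ k^-1 LA) LN.
  have LB1 := L2spinorB (L2spinorZ k^-1 LB) LN.
  have -> : q2 k = nrm (- ((k^-1)%:C *: (wave (fun u => Gs (u - k)) - wave Gs) - (- wave dGs))).
    by rewrite nrmN.
  have LB2 := L2spinorZ (-1) LB1; rewrite rmorphN1 scaleN1r in LB2.
  (* In the difference of the two quotients both [wave Gs] and the limit cancel, leaving [k^-1]
     times the distance that bounds the increment. *)
  apply: le_trans (ler_wpM2l (normr_ge0 _) (nrm_triangle LA1 LB2)).
  rewrite -nrmZ; last exact: L2spinorD.
  rewrite opprB addrA subrK -scalerBr scalerA -rmorphM mulfV// rmorph1 scale1r.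
  rewrite opprB addrA subrK.
  by rewrite Ew.
have lim0 : h^-1 *: ((defect G \o shift s) (h *: 1) - defect G s) @[h --> 0^'] --> (0 : R).
  apply/cvgr0Pnorm_le => e e0; near=> h.
  rewrite /= [h *: 1]mulr1.
  have h0 : h != 0 by near: h; exact: nbhs_dnbhs_neq.
  apply: le_trans (step h h0) _; apply: le_trans (ler_norm _) _.
  by near: h; move/cvgr0Pnorm_le : q12_0; apply.
split; first by apply/cvg_ex; exists 0.
exact/cvg_lim.
Unshelve. all: by end_near. Qed.

Lemma evolution_wave_C1 G dG (t : R) : L2contC G -> L2contC dG -> is_deriveC G dG ->
  defect G t = 0.
Proof.
move=> LG LdG GdG.
have Lw H := @L2spinor_wave R theta m C hm C0 chi1 H.
(* The derivative vanishes at every time, so the value at [t] is the value at 0, where [U 0] is the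
   identity almost everywhere. *)
rewrite (is_derive_0_is_cst (f := defect G) t 0 (fun x => is_derive_defect x LG LdG GdG)).
rewrite /defect.
have -> : (fun u => G (u - 0)) = G by apply/funext => u; rewrite subr0.
have LU0 := ug_L2 hU.1 0 (Lw _ LG).
have L0 : L2spinor (wave G - wave G) by exact: L2spinorB (Lw _ LG) (Lw _ LG).
have -> : nrm (U 0 (wave G) - wave G) = nrm (wave G - wave G).
  apply: nrm_ae => //; first exact: (L2spinorB LU0 (Lw _ LG)).
  have := ug_0 hU.1 (Lw _ LG); apply: ae2_imp => x /= + _ => /(_ I) e.
  by rewrite -[LHS]/(U 0 (wave G) x - wave G x) e.
have -> : wave G - wave G = (0 : R)%:C *: (wave G) by rewrite subrr scale0r.
by rewrite nrmZ// ?normr0 ?mul0r//; exact: Lw.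
Qed.

(* Steklov averages of G are C^1, and U t and the translation are both isometric. *)
Lemma evolution_wave G (t : R) : L2contC G -> defect G t = 0.
Proof.
move=> LG; have Lw H := @L2spinor_wave R theta m C hm C0 chi1 H.
have N := wave_avg_cvg theta hm C0 chi1 LG.
have bd h : h != 0 -> defect G t <= 2 * nrm (wave (fun u => avgC h G u - G u)).
  move=> h0; have LA := L2contC_avgC h LG.
  have LdA : L2contC (fun u => (h^-1)%:C * (G u - G (u - h))).
    by apply: L2contCZ; apply: L2contCB => //; exact: L2contC_shift.
  have := evolution_wave_C1 t LA LdA (is_deriveC_avgC LG h0).
  have LUA := ug_L2 hU.1 t (Lw _ LA); have LUG := ug_L2 hU.1 t (Lw _ LG).
  have LtA := L2contC_shift t LA; have LtG := L2contC_shift t LG.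
  rewrite /defect => A0.
  (* Telescoping through the average of [G]: the middle piece is its own defect, which is 0, and the
     outer two both have the norm of [wave (avgC h G - G)]. Hence the factor 2. *)
  have -> : U t (wave G) - wave (fun u => G (u - t)) =
      (U t (wave G) - U t (wave (avgC h G))) +
      ((U t (wave (avgC h G)) - wave (fun u => avgC h G (u - t))) +
       (wave (fun u => avgC h G (u - t)) - wave (fun u => G (u - t)))).
    by rewrite addrA [X in _ = X + _]addrA subrK addrA subrK.
  have L1 := L2spinorB LUG LUA.
  have L2 := L2spinorB LUA (Lw _ LtA).
  have L3 := L2spinorB (Lw _ LtA) (Lw _ LtG).
  apply: le_trans (nrm_triangle L1 (L2spinorD L2 L3)) _.
  rewrite (nrm_unitaryB hU.1)//; try exact: Lw.
  rewrite (nrmBC (Lw _ LG) (Lw _ LA)) waveB mulr_natl mulr2n lerD2l.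
  apply: le_trans (nrm_triangle L2 L3) _; rewrite A0 add0r waveB.
  by rewrite (nrm_wave_shift theta hm C0 chi1 t (L2contCB LA LG)).
apply/eqP; rewrite eq_le nrm_ge0 andbT.
have N2 : 2 * nrm (wave (fun u => avgC k G u - G u)) @[k --> 0^'] --> 0.
  by rewrite -[X in _ --> X](mulr0 2); apply: cvgM => //; exact: cvg_cst.
apply: (cvgr_to_ge N2); near=> h; apply: bd.
by near: h; exact: nbhs_dnbhs_neq.
Unshelve. all: by end_near. Qed.

End evolution.

Theorem corollary2p5 (R : realType) (theta : R) (m : R -> R) (C : R)
    (g : R -> R[i]) (U : R -> spinor R -> spinor R)
    (htheta : 0 <= theta < 2 * pi)
    (hm : domain_wall_profile m)
    (hC : 0 < C)
    (hchi : ('N[lebesgue1 R]_2%:E[(fun u => (chi C m u)%:E)] = 1)%E)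
    (hg : L2C (lebesgue1 R) g)
    (hgc : continuous (g : R -> R[i]^o))
    (hU : is_exp_group (dirac_graph theta m) U)
    (t : R) :
  U t (fun x => ((chi C m (ndot theta x))%:C * g (tdot theta x)) *:
         vec2 (cos (theta / 2))%:C ('i%C * (sin (theta / 2))%:C))
  = (fun x => ((chi C m (ndot theta x))%:C * g (tdot theta x - t)) *:
         vec2 (cos (theta / 2))%:C ('i%C * (sin (theta / 2))%:C))
  %[ae lebesgue2 R].
Proof.
have chi1 : (\int[@lebesgue_measure R]_u (chi C m u ^+ 2)%:E = 1)%E.
  (* The normalization bounds nothing but the square root of the integral; raising it to the power 2
     returns the integral itself. *)
  have := hchi; rewrite [LHS](@Lnorm2E _ _ _ (@lebesgue_measure R) (chi C m)) => E.
  rewrite -[LHS]poweRe1; last by apply: integral_ge0 => u _; rewrite lee_fin sqr_ge0.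
  by rewrite -(@mulVf R 2)// poweRrM E poweR1r mulVf.
have Lg : L2contC g.
  have [Lr Li] := hg.
  (* Any coordinate that does not increase the complex modulus inherits the continuity of [g]. *)
  have crd (f : R[i] -> R) : (forall z w : R[i], (`|f z - f w|)%:C <= `|z - w|) ->
      continuous (fun u => f (g u)).
    move=> fle u; apply/cvgrPdist_lt => e e0.
    have /cvgrPdist_lt/(_ e%:C) := hgc u; rewrite ltcR => /(_ e0).
    by apply: filterS => v guv; rewrite -ltcR (le_lt_trans (fle _ _)).
  split; split => //; apply: crd => z w.
    by rewrite -cReN -cReD; exact: normc_ge_Re.
  (* The bound for imaginary parts follows from the one for real parts, since [Re (z * i) = - Im z]
     and i has modulus 1. *)
  rewrite -cImN -cImD; have := normc_ge_Re ((z - w) * 'i%C).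
  have i1 : `|'i%C| = 1 :> R[i] by rewrite normc_def /= expr0n add0r expr1n sqrtr1.
  by rewrite ReiNIm normrN normrM i1 mulr1.
have Lw H := @L2spinor_wave R theta m C hm hC chi1 H.
apply: nrm_eq0.
- exact: (ug_L2 hU.1 t (Lw _ Lg)).
- exact: (Lw _ (L2contC_shift t Lg)).
- exact: (evolution_wave hm hC chi1 hU t Lg).
Qed.
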